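(* The following is provable in $\mathsf{RCA}_0$: every partial order not containing $\mathbf{2}\oplus\mathbf{2}$ is an interval order.
   Context: $\mathsf{RCA}_0$ is the base subsystem of second-order arithmetic ($\Delta^0_1$ comprehension, $\Sigma^0_1$ induction). A partial order $\mathbf{P}=(P,\leq_P)$ is a set $P\subseteq\mathbb{N}$ with a reflexive, transitive, antisymmetric relation; a linear order has any two elements comparable; $p<_P q$ means $p\leq_P q$, $p\ne q$. $\mathbf{P}$ is an interval order if there are a linear order $\mathbf{L}=(L,\leq_L)$ and a set $F\subseteq P\times L$ such that, with $F(p)=\{x\in L:(p,x)\in F\}$: (i1) for every $p$, $F(p)\ne\emptyset$ and $x,y\in F(p)$, $z\in L$, $x<_L z<_L y$ imply $z\in F(p)$; (i2) $p<_P q$ iff $x<_L y$ for all $x\in F(p),y\in F(q)$. $\mathbf{P}$ does not contain $\mathbf{2}\oplus\mathbf{2}$ if for all $p_0,q_0,p_1,q_1\in P$, $p_0<_P q_0$ and $p_1<_P q_1$ imply $p_0\leq_P q_1$ or $p_1\leq_P q_0$. *)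

(* Defs.v *)
From Stdlib Require Import List.
Import ListNotations.

(** * Two-sorted syntax of second-order arithmetic

    Variables are de Bruijn indices, with separate numberings for the two
    sorts: a number quantifier does not shift set variables, nor does a set
    quantifier shift number variables. The only set terms are variables. *)

Inductive term : Type :=
| Var (n : nat)
| Zero
| One
| Plus (s t : term)
| Times (s t : term).

Inductive form : Type :=
| Eq (s t : term)
| Lt (s t : term)
| In (t : term) (X : nat)
| Bot
| Imp (A B : form)
| And (A B : form)
| Or (A B : form)
| All (A : form)
| Ex (A : form)
| AllS (A : form)
| ExS (A : form).

Definition Neg (A : form) : form := Imp A Bot.
Definition Iff (A B : form) : form := And (Imp A B) (Imp B A).

Declare Scope term_scope.
Delimit Scope term_scope with term.
Bind Scope term_scope with term.
Declare Scope form_scope.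
Delimit Scope form_scope with form.
Bind Scope form_scope with form.

Notation "# n" := (Var n) (at level 1, n at level 1, format "# n") : term_scope.
Notation "0" := Zero : term_scope.
Notation "1" := One : term_scope.
Infix "+" := Plus : term_scope.
Infix "*" := Times : term_scope.

Infix "==" := Eq (at level 70, no associativity) : form_scope.
Infix "<" := Lt : form_scope.
Infix "\in" := In (at level 70, no associativity) : form_scope.
Notation "~ A" := (Neg A) : form_scope.
Infix "/\" := And : form_scope.
Infix "\/" := Or : form_scope.
Infix "-->" := Imp (at level 90, right associativity) : form_scope.
Infix "<-->" := Iff (at level 95, no associativity) : form_scope.

(** ** Simultaneous substitution of terms for number variables and of set
    variables for set variables *)

Definition scons {X : Type} (x : X) (f : nat -> X) (n : nat) : X :=
  match n with O => x | S m => f m end.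

Fixpoint tsubst (sigma : nat -> term) (t : term) : term :=
  match t with
  | Var n => sigma n
  | Zero => Zero
  | One => One
  | Plus s t => Plus (tsubst sigma s) (tsubst sigma t)
  | Times s t => Times (tsubst sigma s) (tsubst sigma t)
  end.

Definition tshift : term -> term := tsubst (fun n => Var (S n)).

Definition up (sigma : nat -> term) : nat -> term :=
  scons (Var O) (fun n => tshift (sigma n)).

Definition upS (rho : nat -> nat) : nat -> nat :=
  scons O (fun n => S (rho n)).

Fixpoint subst (sigma : nat -> term) (rho : nat -> nat) (A : form) : form :=
  match A with
  | Eq s t => Eq (tsubst sigma s) (tsubst sigma t)
  | Lt s t => Lt (tsubst sigma s) (tsubst sigma t)
  | In t X => In (tsubst sigma t) (rho X)
  | Bot => Bot
  | Imp A B => Imp (subst sigma rho A) (subst sigma rho B)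
  | And A B => And (subst sigma rho A) (subst sigma rho B)
  | Or A B => Or (subst sigma rho A) (subst sigma rho B)
  | All A => All (subst (up sigma) rho A)
  | Ex A => Ex (subst (up sigma) rho A)
  | AllS A => AllS (subst sigma (upS rho) A)
  | ExS A => ExS (subst sigma (upS rho) A)
  end.

Definition shift : form -> form := subst (fun n => Var (S n)) (fun X => X).
Definition shiftS : form -> form := subst Var S.

(** Instantiation of index 0 of the given sort. *)
Definition inst (t : term) : form -> form :=
  subst (scons t Var) (fun X => X).
Definition instS (X : nat) : form -> form :=
  subst Var (scons X (fun Y => Y)).

(** ** Classical natural deduction from a set [T] of axioms

    The eigenvariable conditions are expressed by shifting the local
    assumptions [G]. Axioms are not shifted, so an open axiom has the force of
    its universal closure. *)

Inductive derives (T : form -> Prop) : list form -> form -> Prop :=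
| d_ax G A : T A -> derives T G A
| d_hyp G A : List.In A G -> derives T G A
| d_impI G A B : derives T (A :: G) B -> derives T G (Imp A B)
| d_impE G A B : derives T G (Imp A B) -> derives T G A -> derives T G B
| d_raa G A : derives T (Neg A :: G) Bot -> derives T G A
| d_andI G A B : derives T G A -> derives T G B -> derives T G (And A B)
| d_andE1 G A B : derives T G (And A B) -> derives T G A
| d_andE2 G A B : derives T G (And A B) -> derives T G B
| d_orI1 G A B : derives T G A -> derives T G (Or A B)
| d_orI2 G A B : derives T G B -> derives T G (Or A B)
| d_orE G A B C : derives T G (Or A B) ->
    derives T (A :: G) C -> derives T (B :: G) C -> derives T G C
| d_allI G A : derives T (map shift G) A -> derives T G (All A)
| d_allE G A t : derives T G (All A) -> derives T G (inst t A)
| d_exI G A t : derives T G (inst t A) -> derives T G (Ex A)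
| d_exE G A C : derives T G (Ex A) ->
    derives T (A :: map shift G) (shift C) -> derives T G C
| d_allSI G A : derives T (map shiftS G) A -> derives T G (AllS A)
| d_allSE G A X : derives T G (AllS A) -> derives T G (instS X A)
| d_exSI G A X : derives T G (instS X A) -> derives T G (ExS A)
| d_exSE G A C : derives T G (ExS A) ->
    derives T (A :: map shiftS G) (shiftS C) -> derives T G C
| d_eqI G t : derives T G (Eq t t)
| d_eqE G A s t : derives T G (Eq s t) ->
    derives T G (inst s A) -> derives T G (inst t A).

Definition provable (T : form -> Prop) (A : form) : Prop := derives T [] A.

(** In a bounded quantifier the bound does not contain the bound variable,
    hence [tshift t]. Set parameters are allowed. *)
Inductive Delta0 : form -> Prop :=
| D0_eq s t : Delta0 (Eq s t)
| D0_lt s t : Delta0 (Lt s t)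
| D0_in t X : Delta0 (In t X)
| D0_bot : Delta0 Bot
| D0_imp A B : Delta0 A -> Delta0 B -> Delta0 (Imp A B)
| D0_and A B : Delta0 A -> Delta0 B -> Delta0 (And A B)
| D0_or A B : Delta0 A -> Delta0 B -> Delta0 (Or A B)
| D0_ball t A : Delta0 A -> Delta0 (All (Imp (Lt (Var O) (tshift t)) A))
| D0_bex t A : Delta0 A -> Delta0 (Ex (And (Lt (Var O) (tshift t)) A)).

Inductive Sigma1 : form -> Prop :=
| Sigma1_intro A : Delta0 A -> Sigma1 (Ex A).

Inductive Pi1 : form -> Prop :=
| Pi1_intro A : Delta0 A -> Pi1 (All A).

(** [A(n+1)] when [#0] stands for [n] in [A]; still open in [#0]. *)
Definition at_succ (A : form) : form :=
  subst (scons (#0 + 1)%term (fun n => Var (S n))) (fun X => X) A.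

Definition induction_axiom (A : form) : form :=
  (inst 0 A /\ All (A --> at_succ A) --> All A)%form.

(** [shiftS A] expresses that the set being defined is not free in [A]. *)
Definition comprehension_axiom (A B : form) : form :=
  (All (A <--> B) --> ExS (All (#0 \in 0 <--> shiftS A)))%form.

Inductive RCA0 : form -> Prop :=
| ax_succ_neq0 : RCA0 (~ #0 + 1 == 0)
| ax_succ_inj : RCA0 (#0 + 1 == #1 + 1 --> #0 == #1)
| ax_add0 : RCA0 (#0 + 0 == #0)
| ax_addS : RCA0 (#0 + (#1 + 1) == (#0 + #1) + 1)
| ax_mul0 : RCA0 (#0 * 0 == 0)
| ax_mulS : RCA0 (#0 * (#1 + 1) == #0 * #1 + #0)
| ax_lt0 : RCA0 (~ #0 < 0)
| ax_ltS : RCA0 (#0 < #1 + 1 <--> #0 < #1 \/ #0 == #1)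
| ax_Sigma1_induction A : Sigma1 A -> RCA0 (induction_axiom A)
| ax_Delta1_comprehension A B :
    Sigma1 A -> Pi1 B -> RCA0 (comprehension_axiom A B).

(** Below, [P], [R], ... : nat are indices of set variables. *)

(** The injective coding (i, j) |-> (i + j)^2 + i, as in Simpson's
    "Subsystems of Second Order Arithmetic"; sets of pairs are sets of codes. *)
Definition pair (i j : term) : term := ((i + j) * (i + j) + i)%term.

Definition rel (R : nat) (a b : term) : form := (pair a b \in R)%form.

Definition srel (R : nat) (a b : term) : form :=
  (rel R a b /\ ~ a == b)%form.

Definition sub_product (R P Q : nat) : form :=
  (All (#0 \in R -->
     Ex (Ex (#1 \in P /\ #0 \in Q /\ #2 == pair #1 #0))))%form.

Definition reflexive (P R : nat) : form :=
  (All (#0 \in P --> rel R #0 #0))%form.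

Definition transitive (P R : nat) : form :=
  (All (All (All (#0 \in P /\ #1 \in P /\ #2 \in P -->
     rel R #0 #1 /\ rel R #1 #2 --> rel R #0 #2))))%form.

Definition antisymmetric (P R : nat) : form :=
  (All (All (#0 \in P /\ #1 \in P -->
     rel R #0 #1 /\ rel R #1 #0 --> #0 == #1)))%form.

Definition partial_order (P R : nat) : form :=
  (sub_product R P P /\ reflexive P R /\ transitive P R
   /\ antisymmetric P R)%form.

Definition linear_order (L R : nat) : form :=
  (partial_order L R /\
   All (All (#0 \in L /\ #1 \in L --> rel R #0 #1 \/ rel R #1 #0)))%form.

(** With p0 = #0, q0 = #1, p1 = #2, q1 = #3. *)
Definition no_two_plus_two (P R : nat) : form :=
  (All (All (All (All
     (#0 \in P /\ #1 \in P /\ #2 \in P /\ #3 \in P -->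
      srel R #0 #1 /\ srel R #2 #3 --> rel R #0 #3 \/ rel R #2 #1)))))%form.

Definition in_F (L F : nat) (p x : term) : form :=
  (x \in L /\ pair p x \in F)%form.

(** With p = #0 in the first conjunct and p = #3, x = #2, y = #1, z = #0 in
    the second. *)
Definition interval_i1 (P L RL F : nat) : form :=
  (All (#0 \in P --> Ex (in_F L F #1 #0)) /\
   All (#0 \in P -->
     All (All (All
       (in_F L F #3 #2 /\ in_F L F #3 #1 /\ #0 \in L -->
        srel RL #2 #0 /\ srel RL #0 #1 --> in_F L F #3 #0)))))%form.

(** With p = #1, q = #0 outside, p = #3, q = #2, x = #1, y = #0 inside. *)
Definition interval_i2 (P R L RL F : nat) : form :=
  (All (All (#1 \in P /\ #0 \in P -->
     (srel R #1 #0 <-->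
      All (All (in_F L F #3 #1 /\ in_F L F #2 #0 --> srel RL #1 #0))))))%form.

(** The existentially quantified sets are L = 2, <=_L = 1 and F = 0. *)
Definition interval_order (P R : nat) : form :=
  ExS (ExS (ExS
    (linear_order 2 1 /\
     sub_product 0 (3 + P) 2 /\
     interval_i1 (3 + P) 2 1 0 /\
     interval_i2 (3 + P) (3 + R) 2 1 0)%form)).

(* Main.v *)
From Stdlib Require Import List Lia Classical ClassicalEpsilon.
From Stdlib Require Import FunctionalExtensionality PropExtensionality.
From Stdlib Require Import ProofIrrelevance Cantor PeanoNat Ring.
Require Import Defs.
Import ListNotations.

(** By the completeness theorem it suffices to argue in an arbitrary, possibly
    nonstandard, model of RCA0.

    For [p] and [q] equal or incomparable, extend [{p, q}] to a maximal
    antichain [A_(p,q)] greedily, running through the elements of the order in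
    increasing numerical order. In the absence of 2+2, any two maximal
    antichains are either equal or separated, one containing an element below
    an element of the other, and separation is a strict linear order on them.
    The linear order [L] consists of the codes of the pairs [(p, q)], ordered by
    separation of [A_(p,q)], and numerically where these antichains coincide;
    [F(i)] is the set of codes [x] with [i] in [A_x]. If [i < j] then
    every antichain through [i] is separated from every one through [j], whereas
    incomparable [i] and [j] both lie in [A_(i,j)].

    The family [A] is Delta1, by coding the stages of the greedy construction
    with Goedel's beta function. Separation is even Delta0 in it: if [A_x] and
    [A_y] are not separated by elements up to [x + y], then they are equal. *)

(** * Substitution *)

Lemma tsubst_comp (f g : nat -> term) (t : term) :
  tsubst g (tsubst f t) = tsubst (fun n => tsubst g (f n)) t.
Proof. induction t; simpl; congruence. Qed.

Lemma tsubst_id (t : term) : tsubst Var t = t.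
Proof. induction t; simpl; congruence. Qed.

Lemma up_comp (f g : nat -> term) :
  (fun n => tsubst (up g) (up f n)) = up (fun n => tsubst g (f n)).
Proof.
  apply functional_extensionality; intros [|n]; [reflexivity|].
  cbn; unfold tshift; rewrite !tsubst_comp; reflexivity.
Qed.

Lemma upS_comp (f g : nat -> nat) :
  (fun n => upS g (upS f n)) = upS (fun n => g (f n)).
Proof. apply functional_extensionality; intros [|n]; reflexivity. Qed.

Lemma up_id : up Var = Var.
Proof. apply functional_extensionality; intros [|n]; reflexivity. Qed.

Lemma upS_id : upS (fun X => X) = (fun X => X).
Proof. apply functional_extensionality; intros [|n]; reflexivity. Qed.

Lemma subst_comp (A : form) : forall f g r q,
  subst g q (subst f r A) = subst (fun n => tsubst g (f n)) (fun X => q (r X)) A.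
Proof.
  induction A; intros; simpl; f_equal; auto using tsubst_comp;
    rewrite IHA, ?up_comp, ?upS_comp; reflexivity.
Qed.

Lemma subst_id (A : form) : subst Var (fun X => X) A = A.
Proof.
  induction A; simpl; rewrite ?tsubst_id, ?up_id, ?upS_id; congruence.
Qed.

(** * Bounds on free indices, and universal closures *)

Fixpoint tbound (t : term) : nat :=
  match t with
  | Var n => S n
  | Zero | One => O
  | Plus s t | Times s t => Nat.max (tbound s) (tbound t)
  end.

Fixpoint nbound (A : form) : nat :=
  match A with
  | Eq s t | Lt s t => Nat.max (tbound s) (tbound t)
  | In t _ => tbound t
  | Bot => O
  | Imp A B | And A B | Or A B => Nat.max (nbound A) (nbound B)
  | All A | Ex A => pred (nbound A)
  | AllS A | ExS A => nbound A
  end.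

Fixpoint sbound (A : form) : nat :=
  match A with
  | Eq _ _ | Lt _ _ | Bot => O
  | In _ X => S X
  | Imp A B | And A B | Or A B => Nat.max (sbound A) (sbound B)
  | All A | Ex A => sbound A
  | AllS A | ExS A => pred (sbound A)
  end.

Lemma tsubst_agree (f g : nat -> term) (t : term) :
  (forall n, n < tbound t -> f n = g n) -> tsubst f t = tsubst g t.
Proof.
  induction t; simpl; intros H; try reflexivity.
  - apply H; lia.
  - rewrite IHt1, IHt2; [reflexivity| |]; intros; apply H; lia.
  - rewrite IHt1, IHt2; [reflexivity| |]; intros; apply H; lia.
Qed.

Lemma subst_agree (A : form) : forall f g r q,
  (forall n, n < nbound A -> f n = g n) ->
  (forall X, X < sbound A -> r X = q X) ->
  subst f r A = subst g q A.
Proof.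
  induction A; simpl; intros f g r q Hn Hs; try reflexivity; f_equal;
    try (apply tsubst_agree; intros; apply Hn; lia);
    try (apply Hs; lia);
    try (apply IHA1; intros; [apply Hn|apply Hs]; lia);
    try (apply IHA2; intros; [apply Hn|apply Hs]; lia);
    apply IHA; try assumption; intros [|n] Hlt; try reflexivity; cbn.
  - rewrite Hn; [reflexivity|lia].
  - rewrite Hn; [reflexivity|lia].
  - rewrite Hs; [reflexivity|lia].
  - rewrite Hs; [reflexivity|lia].
Qed.

Definition closed (A : form) : Prop := nbound A = O /\ sbound A = O.

Lemma subst_closed (A : form) f r : closed A -> subst f r A = A.
Proof.
  intros [Hn Hs]. rewrite <- (subst_id A) at 2.
  apply subst_agree; intros; lia.
Qed.

Definition closure (A : form) : form :=
  Nat.iter (nbound A) All (Nat.iter (sbound A) AllS A).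

Lemma closure_closed (A : form) : closed (closure A).
Proof.
  assert (HS : forall n, nbound (Nat.iter n AllS A) = nbound A
             /\ sbound (Nat.iter n AllS A) = sbound A - n).
  { induction n as [|n [IH1 IH2]]; simpl; [lia|]. rewrite IH1, IH2; lia. }
  assert (HN : forall n B, nbound (Nat.iter n All B) = nbound B - n
             /\ sbound (Nat.iter n All B) = sbound B).
  { induction n as [|n IH]; intros B; simpl; [lia|].
    destruct (IH B) as [-> ->]; lia. }
  unfold closed, closure.
  destruct (HN (nbound A) (Nat.iter (sbound A) AllS A)) as [-> ->].
  destruct (HS (sbound A)) as [-> ->]. lia.
Qed.

(** Unlike open axioms, closed ones are invariant under substitution, so that
    derivations from them can be substituted into. *)
Definition closures (T : form -> Prop) (B : form) : Prop :=
  exists A, T A /\ B = closure A.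

(** [d_ax] is available over every list of assumptions, so the shifting of [G] by the introduction
    rules is harmless. This is how open axioms acquire the force of their closures. *)
Lemma derives_closure (T : form -> Prop) (A : form) :
  T A -> forall G, derives T G (closure A).
Proof.
  intros HA. unfold closure.
  assert (HS : forall n G, derives T G (Nat.iter n AllS A)).
  { induction n; intros G; simpl; [now apply d_ax|now apply d_allSI]. }
  induction (nbound A); intros G; simpl; [apply HS|now apply d_allI].
Qed.

Lemma derives_of_closures (T : form -> Prop) G A :
  derives (closures T) G A -> derives T G A.
Proof.
  induction 1; try (now econstructor; eauto).
  destruct H as (B & HB & ->); now apply derives_closure.
Qed.

(** * Weakening and substitution in derivations *)

Lemma derives_weaken (T : form -> Prop) G A :
  derives T G A -> forall G', incl G G' -> derives T G' A.
Proof.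
  assert (Hc : forall (B : form) G G', incl G G' -> incl (B :: G) (B :: G')).
  { intros B G1 G2 H C [->|HC]; [now left|right; now apply H]. }
  induction 1; intros G' Hi; try (now econstructor; eauto);
    try (now econstructor; eauto using incl_map).
Qed.

Lemma shift_subst (A : form) f r :
  subst (up f) r (shift A) = shift (subst f r A).
Proof. unfold shift; rewrite !subst_comp; reflexivity. Qed.

Lemma shiftS_subst (A : form) f r :
  subst f (upS r) (shiftS A) = shiftS (subst f r A).
Proof.
  unfold shiftS; rewrite !subst_comp. f_equal.
  apply functional_extensionality; intros n; cbn; now rewrite tsubst_id.
Qed.

Lemma inst_up (A : form) f r t :
  inst t (subst (up f) r A) = subst (scons t f) r A.
Proof.
  unfold inst; rewrite subst_comp; f_equal.
  apply functional_extensionality; intros [|n]; [reflexivity|].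
  cbn; unfold tshift; rewrite tsubst_comp; apply tsubst_id.
Qed.

Lemma instS_upS (A : form) f r X :
  instS X (subst f (upS r) A) = subst f (scons X r) A.
Proof.
  unfold instS; rewrite subst_comp; f_equal.
  - apply functional_extensionality; intros n; apply tsubst_id.
  - apply functional_extensionality; intros [|n]; reflexivity.
Qed.

Lemma inst_subst (A : form) f r t :
  subst f r (inst t A) = inst (tsubst f t) (subst (up f) r A).
Proof.
  rewrite inst_up; unfold inst; rewrite subst_comp; f_equal.
  apply functional_extensionality; intros [|n]; reflexivity.
Qed.

Lemma instS_subst (A : form) f r X :
  subst f r (instS X A) = instS (r X) (subst f (upS r) A).
Proof.
  rewrite instS_upS; unfold instS; rewrite subst_comp; f_equal.
  apply functional_extensionality; intros [|n]; reflexivity.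
Qed.

Lemma map_shift_subst (G : list form) f r :
  map (subst (up f) r) (map shift G) = map shift (map (subst f r) G).
Proof. rewrite !map_map; apply map_ext; intros; apply shift_subst. Qed.

Lemma map_shiftS_subst (G : list form) f r :
  map (subst f (upS r)) (map shiftS G) = map shiftS (map (subst f r) G).
Proof. rewrite !map_map; apply map_ext; intros; apply shiftS_subst. Qed.

(** In the eigenvariable rules the lifted substitution fixes index 0 and commutes with shifting, so
    the premise keeps its shape; closed axioms are unaffected. *)
Lemma derives_subst (T : form -> Prop) :
  (forall A, T A -> closed A) ->
  forall G A, derives T G A -> forall f r,
  derives T (map (subst f r) G) (subst f r A).
Proof.
  intros HT. induction 1; intros f r.
  - rewrite subst_closed by auto; now apply d_ax.
  - apply d_hyp. now apply in_map.
  - apply d_impI. apply (IHderives f r).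
  - eapply d_impE; [apply (IHderives1 f r)|apply IHderives2].
  - apply d_raa. apply (IHderives f r).
  - apply d_andI; auto.
  - eapply d_andE1; apply (IHderives f r).
  - eapply d_andE2; apply (IHderives f r).
  - apply d_orI1; auto.
  - apply d_orI2; auto.
  - eapply d_orE; [apply (IHderives1 f r)|apply (IHderives2 f r)|apply (IHderives3 f r)].
  - apply d_allI. rewrite <- map_shift_subst. apply IHderives.
  - rewrite inst_subst. apply d_allE. apply (IHderives f r).
  - apply (d_exI _ _ _ (tsubst f t)). rewrite <- inst_subst. apply IHderives.
  - eapply d_exE; [apply (IHderives1 f r)|].
    rewrite <- map_shift_subst, <- shift_subst. apply (IHderives2 (up f) r).
  - apply d_allSI. rewrite <- map_shiftS_subst. apply IHderives.
  - rewrite instS_subst. apply d_allSE. apply (IHderives f r).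
  - apply (d_exSI _ _ _ (r X)). rewrite <- instS_subst. apply IHderives.
  - eapply d_exSE; [apply (IHderives1 f r)|].
    rewrite <- map_shiftS_subst, <- shiftS_subst. apply (IHderives2 f (upS r)).
  - apply d_eqI.
  - rewrite inst_subst. eapply d_eqE; [apply (IHderives1 f r)|].
    rewrite <- inst_subst. apply IHderives2.
Qed.

(** * Models *)

(** Henkin semantics: [sets] is any type with a membership relation, without extensionality. [Eq] is
    read as genuine equality on [dom]. *)
Record model : Type := Model {
  dom : Type;
  sets : Type;
  zero : dom;
  one : dom;
  plus : dom -> dom -> dom;
  times : dom -> dom -> dom;
  less : dom -> dom -> Prop;
  mem : dom -> sets -> Prop
}.

Fixpoint eval (M : model) (e : nat -> dom M) (t : term) : dom M :=
  match t with
  | Var n => e n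
  | Zero => zero M
  | One => one M
  | Plus s t => plus M (eval M e s) (eval M e t)
  | Times s t => times M (eval M e s) (eval M e t)
  end.

Fixpoint sat (M : model) (e : nat -> dom M) (v : nat -> sets M) (A : form)
    : Prop :=
  match A with
  | Eq s t => eval M e s = eval M e t
  | Lt s t => less M (eval M e s) (eval M e t)
  | In t X => mem M (eval M e t) (v X)
  | Bot => False
  | Imp A B => sat M e v A -> sat M e v B
  | And A B => sat M e v A /\ sat M e v B
  | Or A B => sat M e v A \/ sat M e v B
  | All A => forall d, sat M (scons d e) v A
  | Ex A => exists d, sat M (scons d e) v A
  | AllS A => forall X, sat M e (scons X v) A
  | ExS A => exists X, sat M e (scons X v) A
  end.

Definition satisfies (M : model) (T : form -> Prop) : Prop :=
  forall A, T A -> forall e v, sat M e v A.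

Lemma scons_eta {X : Type} (e : nat -> X) : scons (e O) (fun n => e (S n)) = e.
Proof. apply functional_extensionality; intros [|n]; reflexivity. Qed.

Lemma satisfies_of_closures (M : model) (T : form -> Prop) :
  satisfies M (closures T) -> satisfies M T.
Proof.
  intros H A HA.
  assert (HS : forall n, (forall e v, sat M e v (Nat.iter n AllS A)) ->
             forall e v, sat M e v A).
  { induction n; simpl; intros Hn; [exact Hn|apply IHn].
    intros e v. rewrite <- (scons_eta v). apply Hn. }
  assert (HN : forall B n, (forall e v, sat M e v (Nat.iter n All B)) ->
             forall e v, sat M e v B).
  { induction n; simpl; intros Hn; [exact Hn|apply IHn].
    intros e v. rewrite <- (scons_eta e). apply Hn. }
  apply (HS (sbound A)), (HN _ (nbound A)), H. exists A; auto.
Qed.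

Lemma eval_tsubst (M : model) e f t :
  eval M e (tsubst f t) = eval M (fun n => eval M e (f n)) t.
Proof. induction t; simpl; congruence. Qed.

Lemma eval_up (M : model) e f d :
  (fun n => eval M (scons d e) (up f n)) = scons d (fun n => eval M e (f n)).
Proof.
  apply functional_extensionality; intros [|n]; [reflexivity|].
  cbn; unfold tshift; rewrite eval_tsubst; reflexivity.
Qed.

Lemma scons_upS {X : Type} (v : nat -> X) r d :
  (fun n => scons d v (upS r n)) = scons d (fun n => v (r n)).
Proof. apply functional_extensionality; intros [|n]; reflexivity. Qed.

Lemma sat_subst (M : model) (A : form) : forall e v f r,
  sat M e v (subst f r A) <->
  sat M (fun n => eval M e (f n)) (fun X => v (r X)) A.
Proof.
  induction A; intros e v f r; simpl; rewrite ?eval_tsubst; try tauto.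
  - rewrite IHA1, IHA2; tauto.
  - rewrite IHA1, IHA2; tauto.
  - rewrite IHA1, IHA2; tauto.
  - split; intros H d; specialize (H d); [rewrite <- eval_up|rewrite <- eval_up in H];
      now apply IHA.
  - split; intros [d H]; exists d; [rewrite <- eval_up|rewrite <- eval_up in H];
      now apply IHA.
  - split; intros H d; specialize (H d); [rewrite <- scons_upS|rewrite <- scons_upS in H];
      now apply IHA.
  - split; intros [d H]; exists d; [rewrite <- scons_upS|rewrite <- scons_upS in H];
      now apply IHA.
Qed.

(** * Henkin completeness *)

(** A Goedel numbering, by which the Henkin construction runs through all formulas. *)
Fixpoint tcode (t : term) : nat :=
  match t with
  | Var n => to_nat (0, n)
  | Zero => to_nat (1, 0)
  | One => to_nat (2, 0)
  | Plus s t => to_nat (3, to_nat (tcode s, tcode t))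
  | Times s t => to_nat (4, to_nat (tcode s, tcode t))
  end.

Fixpoint fcode (A : form) : nat :=
  match A with
  | Eq s t => to_nat (0, to_nat (tcode s, tcode t))
  | Lt s t => to_nat (1, to_nat (tcode s, tcode t))
  | In t X => to_nat (2, to_nat (tcode t, X))
  | Bot => to_nat (3, 0)
  | Imp A B => to_nat (4, to_nat (fcode A, fcode B))
  | And A B => to_nat (5, to_nat (fcode A, fcode B))
  | Or A B => to_nat (6, to_nat (fcode A, fcode B))
  | All A => to_nat (7, fcode A)
  | Ex A => to_nat (8, fcode A)
  | AllS A => to_nat (9, fcode A)
  | ExS A => to_nat (10, fcode A)
  end.

Lemma to_nat_pair_inj i j i' j' :
  to_nat (i, j) = to_nat (i', j') -> i = i' /\ j = j'.
Proof. intros H; apply to_nat_inj in H; now injection H. Qed.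

Ltac split_codes :=
  repeat match goal with
  | H : to_nat (_, _) = to_nat (_, _) |- _ =>
      apply to_nat_pair_inj in H; destruct H
  end.

Lemma tcode_inj (s : term) : forall t, tcode s = tcode t -> s = t.
Proof.
  induction s; intros [] H; cbn -[to_nat] in H; split_codes;
    try discriminate; f_equal; auto.
Qed.

Lemma fcode_inj (A : form) : forall B, fcode A = fcode B -> A = B.
Proof.
  induction A; intros [] H; cbn -[to_nat] in H; split_codes;
    try discriminate; f_equal; auto using tcode_inj.
Qed.

(** A left inverse of [fcode], arbitrary on numbers that code nothing. *)
Definition form_of_nat (n : nat) : form :=
  epsilon (inhabits Bot) (fun A => fcode A = n).

Lemma form_of_fcode (A : form) : form_of_nat (fcode A) = A.
Proof.
  apply fcode_inj.
  apply (epsilon_spec (inhabits Bot) (fun B => fcode B = fcode A)).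
  now exists A.
Qed.

Section Henkin.

Context (T : form -> Prop) (HT : forall A, T A -> closed A).

Definition consistent (G : list form) : Prop := ~ derives T G Bot.

(** Renaming the fresh variable [k] to 0 and shifting all others turns the
    assumption [inst (Var k) B] into the eigenvariable assumption of [d_exE]. *)
Lemma consistent_Ex G B k :
  (forall A, List.In A (Ex B :: G) -> nbound A <= k) ->
  consistent (Ex B :: G) -> consistent (inst (Var k) B :: Ex B :: G).
Proof.
  intros Hk Hc Hd. apply Hc.
  apply (derives_subst T HT) with
    (f := fun n => if n =? k then Var O else Var (S n)) (r := fun X => X) in Hd.
  apply (d_exE T _ B); [apply d_hyp; now left|].
  eapply derives_weaken; [exact Hd|].
  change (incl (subst (fun n => if n =? k then Var O else Var (S n)) (fun X => X)
    (inst (Var k) B) :: map (subst (fun n => if n =? k then Var O else Var (S n))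
    (fun X => X)) (Ex B :: G)) (B :: map shift (Ex B :: G))).
  replace (subst _ _ (inst (Var k) B)) with B.
  - replace (map (subst _ _) (Ex B :: G)) with (map shift (Ex B :: G));
      [apply incl_refl|].
    apply map_ext_in. intros A HA. apply subst_agree; auto. intros n Hn.
    specialize (Hk A HA). destruct (Nat.eqb_spec n k); [lia|reflexivity].
  - unfold inst. rewrite subst_comp. rewrite <- (subst_id B) at 1.
    apply subst_agree; auto. specialize (Hk _ (or_introl eq_refl)); simpl in Hk.
    intros [|n] Hn; cbn; [now rewrite Nat.eqb_refl|].
    destruct (Nat.eqb_spec n k); [lia|reflexivity].
Qed.

Lemma consistent_ExS G B k :
  (forall A, List.In A (ExS B :: G) -> sbound A <= k) ->
  consistent (ExS B :: G) -> consistent (instS k B :: ExS B :: G).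
Proof.
  intros Hk Hc Hd. apply Hc.
  apply (derives_subst T HT) with
    (f := Var) (r := fun X => if X =? k then O else S X) in Hd.
  apply (d_exSE T _ B); [apply d_hyp; now left|].
  eapply derives_weaken; [exact Hd|].
  change (incl (subst Var (fun X => if X =? k then O else S X) (instS k B)
    :: map (subst Var (fun X => if X =? k then O else S X)) (ExS B :: G))
    (B :: map shiftS (ExS B :: G))).
  replace (subst _ _ (instS k B)) with B.
  - replace (map (subst _ _) (ExS B :: G)) with (map shiftS (ExS B :: G));
      [apply incl_refl|].
    apply map_ext_in. intros A HA. apply subst_agree; auto. intros n Hn.
    specialize (Hk A HA). destruct (Nat.eqb_spec n k); [lia|reflexivity].
  - unfold instS. rewrite subst_comp. rewrite <- (subst_id B) at 1.
    apply subst_agree; auto. specialize (Hk _ (or_introl eq_refl)); simpl in Hk.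
    intros [|n] Hn; cbn; [now rewrite Nat.eqb_refl|].
    destruct (Nat.eqb_spec n k); [lia|reflexivity].
Qed.

Definition fresh (G : list form) : nat :=
  list_max (map (fun A => Nat.max (nbound A) (sbound A)) G).

Lemma fresh_bound G A : List.In A G -> nbound A <= fresh G /\ sbound A <= fresh G.
Proof.
  unfold fresh; induction G as [|B G IH]; simpl; [tauto|].
  intros [->|HA]; [lia|]. specialize (IH HA). lia.
Qed.

(** A Lindenbaum step that adds a witness along with an existential formula. The list stays finite,
    so a fresh variable is always available. *)
Definition extend (G : list form) (A : form) : list form :=
  if excluded_middle_informative (consistent (A :: G)) then
    match A with
    | Ex B => inst (Var (fresh (A :: G))) B :: A :: G
    | ExS B => instS (fresh (A :: G)) B :: A :: G
    | _ => A :: G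
    end
  else G.

Lemma extend_incl G A : incl G (extend G A).
Proof.
  unfold extend. destruct excluded_middle_informative; [|apply incl_refl].
  destruct A; try (apply incl_tl, incl_refl); apply incl_tl, incl_tl, incl_refl.
Qed.

Lemma extend_In G A : consistent (A :: G) -> List.In A (extend G A).
Proof.
  intros H. unfold extend. destruct excluded_middle_informative; [|tauto].
  destruct A; simpl; auto.
Qed.

Lemma extend_consistent G A : consistent G -> consistent (extend G A).
Proof.
  intros H. unfold extend. destruct excluded_middle_informative as [Hc|]; [|auto].
  destruct A; auto; [apply consistent_Ex|apply consistent_ExS]; auto;
    intros B HB; now apply fresh_bound.
Qed.

Context (G0 : list form) (HG0 : consistent G0).

Fixpoint stage (n : nat) : list form :=
  match n with
  | O => G0
  | S n => extend (stage n) (form_of_nat n)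
  end.

Lemma stage_consistent n : consistent (stage n).
Proof. induction n; simpl; auto using extend_consistent. Qed.

Lemma stage_incl m n : m <= n -> incl (stage m) (stage n).
Proof.
  induction 1; [apply incl_refl|].
  eapply incl_tran; [eassumption|apply extend_incl].
Qed.

Definition henkin (A : form) : Prop := exists n, List.In A (stage n).

Lemma henkin_finite G :
  (forall A, List.In A G -> henkin A) -> exists n, incl G (stage n).
Proof.
  induction G as [|A G IH]; intros H; [exists O; intros ? []|].
  destruct IH as [n Hn]; [intros; apply H; now right|].
  destruct (H A (or_introl eq_refl)) as [m Hm].
  exists (n + m). intros B [<-|HB].
  - apply (stage_incl m); [lia|auto].
  - apply (stage_incl n); [lia|auto].
Qed.

(** By whatever route [A] came in, it shares a later stage with the stage that treats it, so the two
    are consistent. Hence [A] was accepted there, with a witness if it is existential. *)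
Lemma henkin_stage A :
  henkin A -> consistent (A :: stage (fcode A)).
Proof.
  intros [n Hn] Hd. apply (stage_consistent (n + fcode A)).
  eapply derives_weaken; [exact Hd|].
  intros B [<-|HB];
    [apply (stage_incl n)|apply (stage_incl (fcode A))]; auto; lia.
Qed.

Lemma henkin_stage_S A :
  stage (S (fcode A)) = extend (stage (fcode A)) A.
Proof. simpl. now rewrite form_of_fcode. Qed.

Lemma henkin_max A : ~ henkin A -> derives T (A :: stage (fcode A)) Bot.
Proof.
  intros H. apply NNPP. intros Hc. apply H. exists (S (fcode A)).
  rewrite henkin_stage_S. now apply extend_In.
Qed.

(** If [A] had been rejected, it would be refuted by its own stage; a later stage containing the
    premises too would then derive both [A] and its negation. *)
Lemma henkin_derives G A :
  derives T G A -> (forall B, List.In B G -> henkin B) -> henkin A.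
Proof.
  intros Hd HG. apply NNPP. intros HA. apply henkin_max in HA.
  destruct (henkin_finite G HG) as [n Hn].
  apply (stage_consistent (n + fcode A)).
  apply (d_impE T _ A).
  - apply d_impI. eapply derives_weaken; [exact HA|].
    apply incl_cons; [now left|]. apply incl_tl, stage_incl; lia.
  - eapply derives_weaken; [exact Hd|].
    eapply incl_tran; [exact Hn|apply stage_incl; lia].
Qed.

(** * Truth conditions satisfied by the Henkin set *)

Lemma henkin_Bot : ~ henkin Bot.
Proof.
  intros [n Hn]. apply (stage_consistent n). now apply d_hyp.
Qed.

Lemma henkin_Neg A : ~ henkin A -> henkin (Neg A).
Proof.
  intros H. apply (henkin_derives (stage (fcode A))).
  - apply d_impI. now apply henkin_max.
  - intros B HB. now exists (fcode A).
Qed.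

Lemma henkin_Imp A B : henkin (Imp A B) <-> (henkin A -> henkin B).
Proof.
  split.
  - intros H HA. apply (henkin_derives [Imp A B; A]).
    + apply (d_impE T _ A); apply d_hyp; simpl; auto.
    + intros C [<-|[<-|[]]]; auto.
  - intros H. destruct (classic (henkin A)) as [HA|HA].
    + apply (henkin_derives [B]).
      * apply d_impI, d_hyp; simpl; auto.
      * intros C [<-|[]]; auto.
    + apply (henkin_derives [Neg A]).
      * apply d_impI, d_raa, (d_impE T _ A); apply d_hyp; simpl; auto.
      * intros C [<-|[]]; now apply henkin_Neg.
Qed.

Lemma henkin_And A B : henkin (And A B) <-> henkin A /\ henkin B.
Proof.
  split.
  - intros H. split; apply (henkin_derives [And A B]);
      try (intros C [<-|[]]; auto).
    + eapply d_andE1, d_hyp; simpl; auto.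
    + eapply d_andE2, d_hyp; simpl; auto.
  - intros [HA HB]. apply (henkin_derives [A; B]).
    + apply d_andI; apply d_hyp; simpl; auto.
    + intros C [<-|[<-|[]]]; auto.
Qed.

Lemma henkin_Or A B : henkin (Or A B) <-> henkin A \/ henkin B.
Proof.
  split.
  - intros H. apply NNPP. intros HN.
    assert (HA : henkin (Neg A)) by (apply henkin_Neg; tauto).
    assert (HB : henkin (Neg B)) by (apply henkin_Neg; tauto).
    apply henkin_Bot, (henkin_derives [Or A B; Neg A; Neg B]).
    + apply (d_orE T _ A B); [apply d_hyp; simpl; auto| |].
      * apply (d_impE T _ A); apply d_hyp; simpl; auto.
      * apply (d_impE T _ B); apply d_hyp; simpl; auto.
    + intros C [<-|[<-|[<-|[]]]]; auto.
  - intros [H|H]; [apply (henkin_derives [A])|apply (henkin_derives [B])];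
      try (intros C [<-|[]]; auto).
    + apply d_orI1, d_hyp; simpl; auto.
    + apply d_orI2, d_hyp; simpl; auto.
Qed.

Lemma henkin_Ex A : henkin (Ex A) <-> exists t, henkin (inst t A).
Proof.
  split.
  - intros H. pose proof (henkin_stage _ H) as Hc.
    exists (Var (fresh (Ex A :: stage (fcode (Ex A))))).
    exists (S (fcode (Ex A))). rewrite henkin_stage_S. unfold extend.
    destruct excluded_middle_informative; [now left|tauto].
  - intros [t H]. apply (henkin_derives [inst t A]).
    + apply (d_exI T _ _ t), d_hyp; simpl; auto.
    + intros C [<-|[]]; auto.
Qed.

Lemma henkin_ExS A : henkin (ExS A) <-> exists X, henkin (instS X A).
Proof.
  split.
  - intros H. pose proof (henkin_stage _ H) as Hc.
    exists (fresh (ExS A :: stage (fcode (ExS A)))).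
    exists (S (fcode (ExS A))). rewrite henkin_stage_S. unfold extend.
    destruct excluded_middle_informative; [now left|tauto].
  - intros [t H]. apply (henkin_derives [instS t A]).
    + apply (d_exSI T _ _ t), d_hyp; simpl; auto.
    + intros C [<-|[]]; auto.
Qed.

Lemma inst_shift_up (A : form) :
  inst (Var O) (subst (up (fun n => Var (S n))) (fun X => X) A) = A.
Proof.
  rewrite inst_up. rewrite <- (subst_id A) at 2. f_equal.
  apply functional_extensionality; intros [|n]; reflexivity.
Qed.

Lemma instS_shiftS_up (A : form) : instS O (subst Var (upS S) A) = A.
Proof.
  rewrite instS_upS. rewrite <- (subst_id A) at 2. f_equal.
  apply functional_extensionality; intros [|n]; reflexivity.
Qed.

(** A witness of [Ex (Neg A)] would contradict the right-hand side, so [Neg (Ex (Neg A))] is in the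
    set, and classically it yields [All A]. *)
Lemma henkin_All A : henkin (All A) <-> forall t, henkin (inst t A).
Proof.
  split.
  - intros H t. apply (henkin_derives [All A]).
    + apply d_allE, d_hyp; simpl; auto.
    + intros C [<-|[]]; auto.
  - intros H. apply NNPP. intros HN.
    assert (HE : ~ henkin (Ex (Neg A))).
    { rewrite henkin_Ex. intros [t Ht]. apply henkin_Bot.
      apply (proj1 (henkin_Imp (inst t A) Bot)); auto. }
    apply henkin_Neg in HE. apply HN, (henkin_derives [Neg (Ex (Neg A))]).
    + apply d_allI, d_raa.
      apply (d_impE T _ (Ex (subst (up (fun n => Var (S n))) (fun X => X) (Neg A)))).
      * apply d_hyp; simpl; auto.
      (* The witness is the eigenvariable itself, which has index 0 after the shift. *)
      * apply (d_exI T _ _ (Var O)). rewrite inst_shift_up. apply d_hyp; simpl; auto.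
    + intros C [<-|[]]; auto.
Qed.

Lemma henkin_AllS A : henkin (AllS A) <-> forall X, henkin (instS X A).
Proof.
  split.
  - intros H t. apply (henkin_derives [AllS A]).
    + apply d_allSE, d_hyp; simpl; auto.
    + intros C [<-|[]]; auto.
  - intros H. apply NNPP. intros HN.
    assert (HE : ~ henkin (ExS (Neg A))).
    { rewrite henkin_ExS. intros [t Ht]. apply henkin_Bot.
      apply (proj1 (henkin_Imp (instS t A) Bot)); auto. }
    apply henkin_Neg in HE. apply HN, (henkin_derives [Neg (ExS (Neg A))]).
    + apply d_allSI, d_raa.
      apply (d_impE T _ (ExS (subst Var (upS S) (Neg A)))).
      * apply d_hyp; simpl; auto.
      * apply (d_exSI T _ _ O). rewrite instS_shiftS_up. apply d_hyp; simpl; auto.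
    + intros C [<-|[]]; auto.
Qed.

(** * Equality and the term model *)

Lemma henkin_refl t : henkin (Eq t t).
Proof. apply (henkin_derives []); [apply d_eqI|intros ? []]. Qed.

Lemma henkin_rewrite A s t :
  henkin (Eq s t) -> henkin (inst s A) -> henkin (inst t A).
Proof.
  intros H1 H2. apply (henkin_derives [Eq s t; inst s A]).
  - apply (d_eqE T _ A s); apply d_hyp; simpl; auto.
  - intros C [<-|[<-|[]]]; auto.
Qed.

Lemma inst_tshift s t : tsubst (scons s Var) (tshift t) = t.
Proof.
  unfold tshift. rewrite tsubst_comp. cbn. apply tsubst_id.
Qed.

Lemma henkin_sym s t : henkin (Eq s t) -> henkin (Eq t s).
Proof.
  intros H. pose proof (henkin_rewrite (Eq (Var O) (tshift s)) s t H) as Hr.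
  cbn in Hr. rewrite !inst_tshift in Hr. apply Hr, henkin_refl.
Qed.

Lemma henkin_trans s t u : henkin (Eq s t) -> henkin (Eq t u) -> henkin (Eq s u).
Proof.
  intros H1 H2. pose proof (henkin_rewrite (Eq (tshift s) (Var O)) t u H2) as Hr.
  cbn in Hr. rewrite !inst_tshift in Hr. auto.
Qed.

(** One argument is replaced at a time, with index 0 marking the place to be rewritten. The
    hypothesis on [h] covers [Plus] and [Times] alike. *)
Lemma henkin_congr (h : term -> term -> term) s s' t t' :
  (forall f a b, tsubst f (h a b) = h (tsubst f a) (tsubst f b)) ->
  henkin (Eq s s') -> henkin (Eq t t') -> henkin (Eq (h s t) (h s' t')).
Proof.
  intros Hh H1 H2. apply (henkin_trans _ (h s' t)).
  - pose proof (henkin_rewrite (Eq (tshift (h s t)) (h (Var O) (tshift t))) s s' H1) as Hr.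
    cbn in Hr. rewrite !Hh, !inst_tshift in Hr. apply Hr, henkin_refl.
  - pose proof (henkin_rewrite (Eq (tshift (h s' t)) (h (tshift s') (Var O))) t t' H2) as Hr.
    cbn in Hr. rewrite !Hh, !inst_tshift in Hr. apply Hr, henkin_refl.
Qed.

(** Elements of the term model are canonical representatives of the terms
    modulo provable equality. *)
Definition repr (t : term) : term := epsilon (inhabits Zero) (fun s => henkin (Eq t s)).

Lemma repr_eq t : henkin (Eq t (repr t)).
Proof.
  apply (epsilon_spec (inhabits Zero) (fun s => henkin (Eq t s))).
  exists t. apply henkin_refl.
Qed.

Lemma repr_congr s t : henkin (Eq s t) -> repr s = repr t.
Proof.
  intros H. unfold repr. f_equal. apply functional_extensionality. intros u.
  apply propositional_extensionality. split; eauto using henkin_trans, henkin_sym.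
Qed.

Definition tdom : Type := {t : term | repr t = t}.

Definition cls (t : term) : tdom :=
  exist _ (repr t) (eq_sym (repr_congr _ _ (repr_eq t))).

Lemma cls_eq s t : cls s = cls t <-> henkin (Eq s t).
Proof.
  split; intros H.
  - injection H as H. eapply henkin_trans; [apply repr_eq|].
    rewrite H. apply henkin_sym, repr_eq.
  - apply subset_eq_compat. now apply repr_congr.
Qed.

Lemma cls_repr (d : tdom) : cls (proj1_sig d) = d.
Proof. destruct d as [t Ht]. now apply subset_eq_compat. Qed.

Definition term_model : model := {|
  dom := tdom;
  sets := nat;
  zero := cls Zero;
  one := cls One;
  plus := fun a b => cls (Plus (proj1_sig a) (proj1_sig b));
  times := fun a b => cls (Times (proj1_sig a) (proj1_sig b));
  less := fun a b => henkin (Lt (proj1_sig a) (proj1_sig b));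
  mem := fun a X => henkin (In (proj1_sig a) X)
|}.

Lemma eval_term_model (f : nat -> term) (t : term) :
  eval term_model (fun n => cls (f n)) t = cls (tsubst f t).
Proof.
  induction t; simpl; try reflexivity; rewrite IHt1, IHt2; apply cls_eq; simpl;
    (apply henkin_congr; [reflexivity| |]; apply henkin_sym, repr_eq).
Qed.

Lemma scons_cls (t : term) (f : nat -> term) :
  scons (cls t) (fun n => cls (f n)) = (fun n => cls (scons t f n)).
Proof. apply functional_extensionality; intros [|n]; reflexivity. Qed.

(** Arbitrary substitutions, rather than the identity, serve as assignments because the quantifier
    cases extend them. *)
Lemma truth (A : form) : forall (f : nat -> term) (r : nat -> nat),
  sat term_model (fun n => cls (f n)) r A <-> henkin (subst f r A).
Proof.
  induction A; intros f r; cbn [sat subst].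
  - rewrite !eval_term_model. apply cls_eq.
  - rewrite !eval_term_model. cbn.
    generalize (tsubst f s), (tsubst f t); clear s t; intros s t; split; intros H.
    + pose proof (henkin_rewrite (Lt (Var O) (tshift (repr t))) _ _
        (henkin_sym _ _ (repr_eq s))) as H1.
      pose proof (henkin_rewrite (Lt (tshift s) (Var O)) _ _
        (henkin_sym _ _ (repr_eq t))) as H2.
      cbn in H1, H2. rewrite !inst_tshift in H1, H2. auto.
    + pose proof (henkin_rewrite (Lt (Var O) (tshift t)) _ _ (repr_eq s)) as H1.
      pose proof (henkin_rewrite (Lt (tshift (repr s)) (Var O)) _ _ (repr_eq t)) as H2.
      cbn in H1, H2. rewrite !inst_tshift in H1, H2. auto.
  - rewrite eval_term_model. cbn. generalize (tsubst f t); clear t; intros t.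
    split; intros H.
    + exact (henkin_rewrite (In (Var O) (r X)) _ _ (henkin_sym _ _ (repr_eq t)) H).
    + exact (henkin_rewrite (In (Var O) (r X)) _ _ (repr_eq t) H).
  - split; [tauto|apply henkin_Bot].
  - rewrite henkin_Imp, IHA1, IHA2. tauto.
  - rewrite henkin_And, IHA1, IHA2. tauto.
  - rewrite henkin_Or, IHA1, IHA2. tauto.
  - rewrite henkin_All. split.
    + intros H t. rewrite inst_up, <- IHA, <- scons_cls. apply H.
    + intros H d. rewrite <- (cls_repr d), scons_cls, IHA, <- inst_up. apply H.
  - rewrite henkin_Ex. split.
    + intros [d H]. exists (proj1_sig d).
      rewrite inst_up, <- IHA, <- scons_cls, cls_repr. exact H.
    + intros [t H]. exists (cls t). rewrite scons_cls, IHA, <- inst_up. exact H.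
  - rewrite henkin_AllS. split; intros H X; specialize (H X).
    + now rewrite instS_upS, <- IHA.
    + now rewrite IHA, <- instS_upS.
  - rewrite henkin_ExS. split; intros [X H]; exists X.
    + now rewrite instS_upS, <- IHA.
    + now rewrite IHA, <- instS_upS.
Qed.

Lemma term_model_satisfies : satisfies term_model T.
Proof.
  intros A HA e v.
  (* Every assignment takes classes of terms as values, so [truth] applies to it. *)
  replace e with (fun n => cls (proj1_sig (e n)))
    by (apply functional_extensionality; intros; apply cls_repr).
  apply truth. rewrite subst_closed by auto.
  apply (henkin_derives []); [now apply d_ax|intros ? []].
Qed.

End Henkin.

(** If [A] is not derivable from the closed axioms, then [Neg A] is consistent with them, and the
    term model of its Henkin set satisfies [T] but refutes [A]. *)
Theorem completeness (T : form -> Prop) (A : form) :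
  closed A ->
  (forall M, satisfies M T -> forall e v, sat M e v A) ->
  provable T A.
Proof.
  intros HA H. apply derives_of_closures. apply NNPP. intros HN.
  assert (HT : forall B, closures T B -> closed B).
  { intros B (C & _ & ->). apply closure_closed. }
  assert (Hc : consistent (closures T) [Neg A]).
  { intros Hd. apply HN. now apply d_raa. }
  assert (Hh : henkin (closures T) [Neg A] (Neg A)) by (exists O; now left).
  apply (henkin_Bot (closures T) HT [Neg A] Hc).
  apply (proj1 (henkin_Imp (closures T) HT [Neg A] Hc A Bot)); [exact Hh|].
  rewrite <- (subst_closed A Var (fun X => X) HA) at 2.
  apply (truth (closures T) HT [Neg A] Hc). apply H.
  apply satisfies_of_closures. now apply term_model_satisfies.
Qed.

(** * Arithmetic in models of RCA0 *)

Definition ball (t : term) (A : form) : form := All (Imp (Lt (Var O) (tshift t)) A).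
Definition bex (t : term) (A : form) : form := Ex (And (Lt (Var O) (tshift t)) A).

Lemma D0_iff A B : Delta0 A -> Delta0 B -> Delta0 (Iff A B).
Proof. intros; unfold Iff; auto using D0_and, D0_imp. Qed.

Lemma D0_neg A : Delta0 A -> Delta0 (Neg A).
Proof. intros; unfold Neg; auto using D0_imp, D0_bot. Qed.

Lemma D0_ball' t A : Delta0 A -> Delta0 (ball t A).
Proof. apply D0_ball. Qed.

Lemma D0_bex' t A : Delta0 A -> Delta0 (bex t A).
Proof. apply D0_bex. Qed.

Create HintDb delta0.
#[local] Hint Resolve D0_eq D0_lt D0_in D0_bot D0_imp D0_and D0_or D0_iff D0_neg
  D0_ball' D0_bex' : delta0.
Ltac delta0 := auto 50 with delta0 nocore.

(** Substitution commutes with [tshift], so a bound still does not contain the bound variable. *)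
Lemma Delta0_subst (A : form) : Delta0 A -> forall f r, Delta0 (subst f r A).
Proof.
  assert (Hs : forall f t, tsubst (up f) (tshift t) = tshift (tsubst f t)).
  { intros; unfold tshift; rewrite !tsubst_comp; reflexivity. }
  induction 1; intros f r; cbn [subst tsubst]; delta0;
    rewrite Hs; constructor; auto.
Qed.

Declare Scope model_scope.
Delimit Scope model_scope with M.

Section RCA0_models.

Context (M : model) (HM : satisfies M RCA0) (v0 : nat -> sets M).

Local Notation D := (dom M).
Bind Scope model_scope with dom.
Local Open Scope model_scope.
Local Notation "0" := (zero M) : model_scope.
Local Notation "1" := (one M) : model_scope.
Local Notation "x + y" := (plus M x y) : model_scope.
Local Notation "x * y" := (times M x y) : model_scope.
Local Notation "x < y" := (less M x y) : model_scope.
Local Infix ".:" := scons (at level 60, right associativity).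

Let e0 : nat -> D := fun _ => 0.

(** In the matrix [A], index 0 is the existential witness, index 1 the induction variable, and the
    remaining indices are parameters. *)
Lemma sigma1_induction A e v : Delta0 A ->
  (exists w, sat M (w .: 0 .: e) v A) ->
  (forall n, (exists w, sat M (w .: n .: e) v A) ->
     exists w, sat M (w .: (n + 1) .: e) v A) ->
  forall n, exists w, sat M (w .: n .: e) v A.
Proof.
  intros HA H0 HS.
  pose proof (HM _ (ax_Sigma1_induction _ (Sigma1_intro A HA)) e v) as H.
  cbn [induction_axiom sat] in H. apply H. clear H. split.
  - unfold inst. apply sat_subst. cbn [sat].
    replace (fun n => eval M e (scons Zero Var n)) with (0 .: e); [exact H0|].
    apply functional_extensionality; intros [|n]; reflexivity.
  - intros n Hn. unfold at_succ. apply sat_subst. cbn [sat].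
    match goal with |- exists d, sat M (d .: ?f) _ _ =>
      replace f with ((n + 1) .: e) end; [now apply HS|].
    apply functional_extensionality; intros [|m]; reflexivity.
Qed.

(** Makes room for a dummy existential quantifier, so that a Delta0 formula can
    be used as a Sigma1 or Pi1 one. *)
Definition pad (A : form) : form := subst (fun n => Var (S n)) (fun X => X) A.

Lemma sat_pad A w e v : sat M (w .: e) v (pad A) <-> sat M e v A.
Proof. unfold pad. rewrite sat_subst. reflexivity. Qed.

Lemma delta0_induction A e v : Delta0 A ->
  sat M (0 .: e) v A ->
  (forall n, sat M (n .: e) v A -> sat M ((n + 1) .: e) v A) ->
  forall n, sat M (n .: e) v A.
Proof.
  intros HA H0 HS n.
  destruct (sigma1_induction (pad A) e v (Delta0_subst A HA _ _)) with (n := n)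
    as [w Hw].
  - exists 0. now apply sat_pad.
  - intros m [w Hw]. exists 0. apply sat_pad, HS. now apply sat_pad in Hw.
  - now apply sat_pad in Hw.
Qed.

Lemma delta1_comprehension A B e v : Delta0 A -> Delta0 B ->
  (forall n, (exists w, sat M (w .: n .: e) v A) <->
     (forall w, sat M (w .: n .: e) v B)) ->
  exists X, forall n, mem M n X <-> exists w, sat M (w .: n .: e) v A.
Proof.
  intros HA HB H.
  pose proof (HM _ (ax_Delta1_comprehension _ _ (Sigma1_intro A HA)
    (Pi1_intro B HB)) e v) as HC.
  cbn [comprehension_axiom sat Iff] in HC.
  destruct HC as [X HX].
  - intros n. specialize (H n). tauto.
  - exists X. intros n. specialize (HX n). unfold shiftS in HX.
    cbn [eval scons] in HX. rewrite sat_subst in HX. cbn in HX. tauto.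
Qed.

Lemma delta0_comprehension A e v : Delta0 A ->
  exists X, forall n, mem M n X <-> sat M (n .: e) v A.
Proof.
  intros HA.
  destruct (delta1_comprehension (pad A) (pad A) e v) as [X HX];
    try (now apply Delta0_subst).
  - intros n. split.
    + intros [w Hw] w'. rewrite sat_pad in *. exact Hw.
    + intros Hw. exists 0. apply Hw.
  - exists X. intros n. rewrite HX. split.
    + intros [w Hw]. now apply sat_pad in Hw.
    + intros Hn. exists 0. now apply sat_pad.
Qed.

(** * The commutative semiring of numbers *)

Lemma succ_neq0 x : x + 1 <> 0.
Proof. exact (HM _ ax_succ_neq0 (x .: e0) v0). Qed.

Lemma succ_inj x y : x + 1 = y + 1 -> x = y.
Proof. exact (HM _ ax_succ_inj (x .: y .: e0) v0). Qed.

Lemma add0 x : x + 0 = x.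
Proof. exact (HM _ ax_add0 (x .: e0) v0). Qed.

Lemma addS x y : x + (y + 1) = (x + y) + 1.
Proof. exact (HM _ ax_addS (x .: y .: e0) v0). Qed.

Lemma mul0 x : x * 0 = 0.
Proof. exact (HM _ ax_mul0 (x .: e0) v0). Qed.

Lemma mulS x y : x * (y + 1) = x * y + x.
Proof. exact (HM _ ax_mulS (x .: y .: e0) v0). Qed.

Lemma not_lt0 x : ~ x < 0.
Proof. exact (HM _ ax_lt0 (x .: e0) v0). Qed.

Lemma lt_succ x y : x < y + 1 <-> x < y \/ x = y.
Proof. exact (HM _ ax_ltS (x .: y .: e0) v0). Qed.

Lemma add_0_l x : 0 + x = x.
Proof.
  apply (delta0_induction (0 + #0 == #0)%form e0 v0); [delta0| |]; cbn.
  - apply add0.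
  - intros n H. now rewrite addS, H.
Qed.

Lemma add_assoc x y z : x + (y + z) = (x + y) + z.
Proof.
  apply (delta0_induction (#1 + (#2 + #0) == #1 + #2 + #0)%form (x .: y .: e0) v0);
    [delta0| |]; cbn.
  - now rewrite !add0.
  - intros n H. now rewrite !addS, H.
Qed.

Lemma add_1_comm x : 1 + x = x + 1.
Proof.
  apply (delta0_induction (1 + #0 == #0 + 1)%form e0 v0); [delta0| |]; cbn.
  - now rewrite add0, add_0_l.
  - intros n H. now rewrite addS, H.
Qed.

Lemma add_comm x y : x + y = y + x.
Proof.
  apply (delta0_induction (#1 + #0 == #0 + #1)%form (x .: e0) v0); [delta0| |]; cbn.
  - now rewrite add0, add_0_l.
  - intros n H. now rewrite addS, H, <- !add_assoc, add_1_comm.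
Qed.

Lemma mul_0_l x : 0 * x = 0.
Proof.
  apply (delta0_induction (0 * #0 == 0)%form e0 v0); [delta0| |]; cbn.
  - apply mul0.
  - intros n H. now rewrite mulS, H, add0.
Qed.

Lemma mul_succ_l x y : (x + 1) * y = x * y + y.
Proof.
  apply (delta0_induction ((#1 + 1) * #0 == #1 * #0 + #0)%form (x .: e0) v0);
    [delta0| |]; cbn.
  - now rewrite !mul0, add0.
  - intros n H. rewrite !mulS, H, !addS. f_equal.
    now rewrite <- !add_assoc, (add_comm n x).
Qed.

Lemma mul_comm x y : x * y = y * x.
Proof.
  apply (delta0_induction (#1 * #0 == #0 * #1)%form (x .: e0) v0); [delta0| |]; cbn.
  - now rewrite mul0, mul_0_l.
  - intros n H. now rewrite mulS, mul_succ_l, H.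
Qed.

Lemma mul_add_l x y z : (x + y) * z = x * z + y * z.
Proof.
  apply (delta0_induction ((#1 + #2) * #0 == #1 * #0 + #2 * #0)%form
    (x .: y .: e0) v0); [delta0| |]; cbn.
  - now rewrite !mul0, add0.
  - intros n H. rewrite !mulS, H, <- !add_assoc. f_equal.
    now rewrite !add_assoc, (add_comm x).
Qed.

Lemma mul_assoc x y z : x * (y * z) = (x * y) * z.
Proof.
  apply (delta0_induction (#1 * (#2 * #0) == (#1 * #2) * #0)%form
    (x .: y .: e0) v0); [delta0| |]; cbn.
  - now rewrite !mul0.
  - intros n H. now rewrite !mulS, <- H, mul_comm, mul_add_l, mul_comm, (mul_comm y x).
Qed.

Lemma mul_1_l x : 1 * x = x.
Proof. now rewrite <- (add_0_l 1), mul_succ_l, mul_0_l, add_0_l. Qed.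

Lemma dom_semiring : semi_ring_theory 0 1 (plus M) (times M) eq.
Proof.
  constructor; auto using add_0_l, add_comm, add_assoc, mul_1_l, mul_0_l,
    mul_comm, mul_assoc, mul_add_l.
Qed.

Add Ring dom_ring : dom_semiring.

(** * Cancellation and the order of the numbers *)

Lemma add_cancel x y z : x + z = y + z -> x = y.
Proof.
  apply (delta0_induction (#1 + #0 == #2 + #0 --> #1 == #2)%form
    (x .: y .: e0) v0); [delta0| |]; cbn.
  - now rewrite !add0.
  - intros n IH H. rewrite !addS in H. now apply IH, succ_inj.
Qed.

Lemma add_neq x d : x + (d + 1) <> x.
Proof.
  intros H. apply (succ_neq0 d), (add_cancel _ _ x). rewrite add_0_l, add_comm. exact H.
Qed.

Lemma zero_or_succ x : x = 0 \/ exists y, x = y + 1.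
Proof.
  assert (H : x = 0 \/ exists y, y < x /\ x = y + 1); [|firstorder].
  apply (delta0_induction (#0 == 0 \/ bex #0 (#1 == #0 + 1))%form e0 v0);
    [delta0| |]; cbn; [now left|].
  intros n _. right. exists n. split; [apply lt_succ|]; auto.
Qed.

(** Sigma1 induction on [y] finds the difference as an unbounded witness, before anything is known
    about the order. *)
Lemma lt_exists x y : x < y -> exists d, y = x + (d + 1).
Proof.
  intros H.
  destruct (sigma1_induction (#2 < #1 --> #1 == #2 + (#0 + 1))%form (x .: e0) v0)
    with (n := y) as [d Hd]; cbn in *.
  - delta0.
  - exists 0. intros H0. now apply not_lt0 in H0.
  - intros n [d Hd]. destruct (classic (x < n)) as [Hn|Hn].
    + exists (d + 1). intros _. rewrite (Hd Hn) at 1. ring.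
    + exists 0. intros Hl. apply lt_succ in Hl as [Hl| ->]; [tauto|ring].
  - exists d. auto.
Qed.

Lemma lt_add x d : x < x + (d + 1).
Proof.
  apply (delta0_induction (#1 < #1 + (#0 + 1))%form (x .: e0) v0); [delta0| |]; cbn.
  - rewrite add_0_l. apply lt_succ. auto.
  - intros n H. rewrite addS. apply lt_succ. auto.
Qed.

Lemma lt_trans x y z : x < y -> y < z -> x < z.
Proof.
  intros [d ->]%lt_exists [f ->]%lt_exists.
  replace (x + (d + 1) + (f + 1)) with (x + ((d + f + 1) + 1)) by ring. apply lt_add.
Qed.

Lemma lt_irrefl x : ~ x < x.
Proof. intros [d Hd]%lt_exists. now apply (add_neq x d). Qed.

Lemma lt_trichotomy x y : x < y \/ x = y \/ y < x.
Proof.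
  apply (delta0_induction (#1 < #0 \/ #1 == #0 \/ #0 < #1)%form (x .: e0) v0);
    [delta0| |]; cbn.
  - destruct (zero_or_succ x) as [->|[z ->]]; [auto|].
    right; right. rewrite <- (add_0_l (z + 1)). apply lt_add.
  - intros n [H|[->|H]].
    + left. apply lt_succ. auto.
    + left. apply lt_succ. auto.
    + apply lt_exists in H as [d ->].
      destruct (zero_or_succ d) as [->|[z ->]].
      * right; left. ring.
      * right; right. replace (n + (z + 1 + 1)) with (n + 1 + (z + 1)) by ring.
        apply lt_add.
Qed.

(** From here on, [x < y + 1] plays the part of the non-strict order. *)
Lemma lt_succ_add x y : x < x + y + 1.
Proof. rewrite <- add_assoc. apply lt_add. Qed.

Lemma lt_succ_exists x y : x < y + 1 -> exists d, y = x + d.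
Proof. intros [d Hd]%lt_exists. exists d. apply succ_inj. rewrite Hd. ring. Qed.

Lemma lt_or_ge x y : x < y \/ exists d, x = y + d.
Proof.
  destruct (lt_trichotomy x y) as [H|[->|H]]; [auto| |].
  - right. exists 0. ring.
  - right. apply lt_exists in H as [d ->]. now exists (d + 1).
Qed.

Lemma lt_succ_cases x y : x < y + 1 \/ y < x.
Proof.
  destruct (lt_trichotomy x y) as [H|[H|H]]; [left|left|auto]; apply lt_succ; auto.
Qed.

(** * Pairing *)

Definition code (i j : D) : D := (i + j) * (i + j) + i.

Lemma square_ge x : exists d, x * x = x + d.
Proof.
  destruct (zero_or_succ x) as [->|[y ->]].
  - exists 0. ring.
  - exists (y * y + y). ring.
Qed.

Lemma code_bound i j : exists d, code i j = i + j + d.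
Proof.
  destruct (square_ge (i + j)) as [d Hd]. exists (d + i).
  unfold code. rewrite Hd. ring.
Qed.

(** Squares are far enough apart: with [s = i + j], the code [s * s + i] is below the square of
    [s + 1], as [i] is at most [s]. *)
Lemma code_sum_le i j i' j' : code i j = code i' j' -> ~ i + j < i' + j'.
Proof.
  intros H Hlt. apply lt_exists in Hlt as [d Hd].
  unfold code in H. rewrite Hd in H.
  (* The second argument is one less than the excess of the code of [i'] and [j'] over that of [i]
     and [j], found by expanding the square. *)
  apply (add_neq (i + (i + j) * (i + j)) (i + j + j + (1 + 1) * (i + j) * d + d * d + d + d + i')).
  transitivity ((i + j + (d + 1)) * (i + j + (d + 1)) + i'); [ring|].
  rewrite <- H. ring.
Qed.

Lemma code_inj i j i' j' : code i j = code i' j' -> i = i' /\ j = j'.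
Proof.
  intros H.
  assert (Hs : i + j = i' + j').
  { destruct (lt_trichotomy (i + j) (i' + j')) as [Hl|[Hl|Hl]]; auto; exfalso.
    - now apply (code_sum_le i j i' j').
    - symmetry in H. now apply (code_sum_le i' j' i j). }
  unfold code in H. rewrite Hs in H.
  assert (Hi : i = i').
  { apply (add_cancel _ _ ((i' + j') * (i' + j'))). rewrite add_comm, H. ring. }
  split; [exact Hi|]. rewrite Hi in Hs.
  apply (add_cancel _ _ i'). rewrite add_comm, Hs. ring.
Qed.

(** * Divisibility *)

Definition divides (m a : D) : Prop := exists d, m * d = a.

Lemma divides_mul m a c : divides m a -> divides m (a * c).
Proof. intros [d <-]. exists (d * c). ring. Qed.

(** For want of subtraction the quotients [d] and [f] are compared: [f < d] would make the sum
    smaller than [a], and otherwise their difference is the quotient for [b]. *)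
Lemma divides_add_cancel w a b : divides (w + 1) a -> divides (w + 1) (a + b) ->
  divides (w + 1) b.
Proof.
  intros [d <-] [f Hf]. destruct (lt_or_ge f d) as [Hl|[g ->]].
  - exfalso. apply lt_exists in Hl as [g ->].
    apply (add_neq ((w + 1) * f) (w * g + w + g + b)).
    transitivity ((w + 1) * (f + (g + 1)) + b); [ring|auto].
  - exists g. apply (add_cancel _ _ ((w + 1) * d)).
    rewrite (add_comm b), <- Hf. ring.
Qed.

Definition modulus (i b : D) : D := (i + 1) * b + 1.

(** Since [m = (i+1)b + 1] is coprime to [b], a factor [e] of [b] cancels. *)
Lemma divides_modulus_cancel i b e a : divides e b ->
  divides (modulus i b) (a * (e * b)) -> divides (modulus i b) a.
Proof.
  intros [f Hf] H. unfold modulus in *. set (w := (i + 1) * b) in *.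
  (* As [e * f = b], the factor [f * (i + 1) * (i + 1) * w] completes [e * b] to the cube of [w]. *)
  assert (H2 : divides (w + 1) (a * (w * (w * w)))).
  { replace (a * (w * (w * w))) with
      ((a * (e * b)) * (f * (i + 1) * (i + 1) * w)).
    - now apply divides_mul.
    - unfold w. rewrite <- Hf. ring. }
  (* Modulo [w + 1] the number [w] is -1, so a factor [w] may be dropped. *)
  assert (step : forall c, divides (w + 1) (c * w) -> divides (w + 1) c).
  { intros c Hc. apply (divides_add_cancel w (c * w)); [exact Hc|].
    exists c. ring. }
  apply step, step, step.
  replace (a * w * w * w) with (a * (w * (w * w))) by ring. exact H2.
Qed.

(** The moduli differ by [b] times the distance of [i] and [k], and this distance divides [b]. So
    modulo [modulus i b] the factor [modulus k b] is, up to sign, one that the previous lemma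
    cancels. *)
Lemma divides_modulus_mul N b i k a :
  (forall d, d < N -> divides (d + 1) b) -> i < N + 1 -> k < N + 1 -> i <> k ->
  divides (modulus i b) (a * modulus k b) -> divides (modulus i b) a.
Proof.
  intros Hb Hi Hk Hne H.
  assert (Hsmall : forall x e, x + (e + 1) < N + 1 -> e < N).
  { intros x e [d Hd]%lt_succ_exists. rewrite Hd.
    replace (x + (e + 1) + d) with (e + (x + d + 1)) by ring. apply lt_add. }
  destruct (lt_trichotomy i k) as [Hl|[Hl|Hl]]; [|tauto|];
    apply lt_exists in Hl as [e ->].
  - apply (divides_modulus_cancel i b (e + 1)); [eauto|].
    apply (divides_add_cancel ((i + 1) * b) (a * modulus i b)).
    + exists a. unfold modulus. ring.
    + replace (a * modulus i b + a * ((e + 1) * b)) with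
        (a * modulus (i + (e + 1)) b) by (unfold modulus; ring). exact H.
  - apply (divides_modulus_cancel _ b (e + 1)); [eauto|].
    apply (divides_add_cancel ((k + (e + 1) + 1) * b) (a * modulus k b)); [exact H|].
    exists a. unfold modulus. ring.
Qed.

(** The witness is the factorial of [N]. Bounding the quotients by [b] keeps the matrix Delta0, and
    [b <> 0] makes every modulus exceed 1. *)
Lemma common_multiple N :
  exists b, b <> 0 /\ forall d, d < N -> divides (d + 1) b.
Proof.
  destruct (sigma1_induction
    (~ #0 == 0 /\ ball #1 (bex (#1 + 1) ((#1 + 1) * #0 == #2)))%form e0 v0)
    with (n := N) as [b [Hb0 Hb]]; cbn in *.
  - delta0.
  - exists 1. split; [rewrite <- (add_0_l 1); apply succ_neq0|].
    intros d Hd. now apply not_lt0 in Hd.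
  - intros n [b [Hb0 Hb]]. exists (b * (n + 1)). split.
    + destruct (zero_or_succ b) as [|[c ->]]; [tauto|].
      replace ((c + 1) * (n + 1)) with (c * n + c + n + 1) by ring.
      apply succ_neq0.
    + intros d Hd. apply lt_succ in Hd as [Hd| ->].
      * destruct (Hb d Hd) as (f & _ & <-). exists (f * (n + 1)). split; [|ring].
        replace ((d + 1) * f * (n + 1) + 1) with
          (f * (n + 1) + (d * f * (n + 1)) + 1) by ring. apply lt_succ_add.
      * exists b. split; [|ring].
        replace (b * (n + 1) + 1) with (b + b * n + 1) by ring. apply lt_succ_add.
  - exists b. split; [exact Hb0|].
    intros d Hd. destruct (Hb d Hd) as (f & _ & Hf). now exists f.
Qed.

(** The number [a], relative to [b], codes the set of all [i] such that
    [modulus i b] divides [a], as in Goedel's beta function. *)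
Definition bit (i b a : term) : form :=
  bex (a + 1) (tshift ((i + 1) * b + 1) * #0 == tshift a)%form.

(** Repeats the bound in [bit], so that satisfaction of [bit] unfolds to it by conversion; [Cond]
    and [Greedy] mirror their formulas likewise. *)
Definition Bit (i b a : D) : Prop :=
  exists d, d < a + 1 /\ modulus i b * d = a.

Lemma Bit_iff i b a : Bit i b a <-> divides (modulus i b) a.
Proof.
  split; intros [d Hd]; exists d; [tauto|]. split; [|exact Hd].
  rewrite <- Hd. unfold modulus.
  replace (((i + 1) * b + 1) * d + 1) with (d + ((i + 1) * b * d) + 1) by ring.
  apply lt_succ_add.
Qed.

(** Together with [Bit_mul_self], this lets a multiplication by [modulus k b] insert [k] into a
    coded set; the start is 1, which codes the empty set. *)
Lemma Bit_mul_other N b i k a :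
  (forall d, d < N -> divides (d + 1) b) -> i < N + 1 -> k < N + 1 -> i <> k ->
  (Bit i b (a * modulus k b) <-> Bit i b a).
Proof.
  intros Hb Hi Hk Hne. rewrite !Bit_iff.
  split; [now apply (divides_modulus_mul N)|apply divides_mul].
Qed.

Lemma Bit_mul_self b k a : Bit k b (a * modulus k b).
Proof. apply Bit_iff. exists a. ring. Qed.

Lemma Bit_one b i : ~ b = 0 -> ~ Bit i b 1.
Proof.
  intros Hb [d [_ Hd]]. destruct (zero_or_succ b) as [|[c ->]]; [tauto|].
  destruct (zero_or_succ d) as [->|[f ->]]; unfold modulus in Hd.
  - apply (succ_neq0 0). rewrite add_0_l, <- Hd. ring.
  - apply (add_neq 1 (f + (i * c + c + i) * (f + 1) + f)). etransitivity; [|exact Hd]. ring.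
Qed.

(** * Greedy maximal antichains *)

(** Equal or incomparable. Set variable 0 is the order and 1 its field, as in [v1] below. *)
Definition inc (i j : term) : form :=
  ((pair i j \in 0 --> i == j) /\ (pair j i \in 0 --> i == j))%form.

(** Comparing [i] with [p] and [q] in advance ensures that no element chosen earlier can exclude
    them. *)
Definition greedy_cond (p q b a i : term) : form :=
  (i \in 1 /\ inc i p /\ inc i q
   /\ ball i (bit #0 (tshift b) (tshift a) --> inc (tshift i) #0))%form.

Definition greedy (p q b a n : term) : form :=
  ball n (bit #0 (tshift b) (tshift a) <-->
    greedy_cond (tshift p) (tshift q) (tshift b) (tshift a) #0)%form.

Lemma bit_D0 i b a : Delta0 (bit i b a).
Proof. unfold bit. delta0. Qed.

Lemma inc_D0 i j : Delta0 (inc i j).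
Proof. unfold inc. delta0. Qed.

#[local] Hint Resolve bit_D0 inc_D0 : delta0.

Lemma greedy_cond_D0 p q b a i : Delta0 (greedy_cond p q b a i).
Proof. unfold greedy_cond. delta0. Qed.

#[local] Hint Resolve greedy_cond_D0 : delta0.

Lemma greedy_D0 p q b a n : Delta0 (greedy p q b a n).
Proof. unfold greedy. delta0. Qed.

#[local] Hint Resolve greedy_D0 : delta0.

(** * The greedy construction inside the model *)

Context (P R : sets M).

Let v1 : nat -> sets M := R .: P .: v0.

Definition Inc (i j : D) : Prop :=
  (mem M (code i j) R -> i = j) /\ (mem M (code j i) R -> i = j).

Definition Cond (A : D -> Prop) (p q i : D) : Prop :=
  mem M i P /\ Inc i p /\ Inc i q /\ forall j, j < i -> A j -> Inc i j.

Definition Greedy (A : D -> Prop) (p q n : D) : Prop :=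
  forall i, i < n -> (A i <-> Cond A p q i).

Lemma Inc_refl i : Inc i i.
Proof. split; auto. Qed.

Lemma Inc_sym i j : Inc i j -> Inc j i.
Proof. intros [H1 H2]; split; intros H; symmetry; auto. Qed.

(** The rule for [i] consults [A] only below [i], which makes the construction a course-of-values
    recursion. *)
Lemma Cond_agree (A A' : D -> Prop) p q i :
  (forall j, j < i -> (A j <-> A' j)) -> Cond A p q i <-> Cond A' p q i.
Proof.
  intros H. unfold Cond.
  split; intros (H1 & H2 & H3 & H4); (split; [auto|split; [auto|split; [auto|]]]);
    intros j Hj HA; apply H4; auto; now apply H.
Qed.

Lemma Greedy_le (A : D -> Prop) p q m n : m < n + 1 -> Greedy A p q n -> Greedy A p q m.
Proof.
  intros Hm HG i Hi. apply HG.
  apply lt_succ in Hm as [Hm| ->]; eauto using lt_trans.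
Qed.

(** Codes that agree below [k] face the same condition at [k]. Uniqueness is what gives membership
    in an antichain its Pi1 form. *)
Lemma Greedy_unique p q n b a b' a' :
  Greedy (fun i => Bit i b a) p q n -> Greedy (fun i => Bit i b' a') p q n ->
  forall i, i < n -> (Bit i b a <-> Bit i b' a').
Proof.
  intros HG HG'.
  assert (H : forall k i, i < k -> i < n -> (Bit i b a <-> Bit i b' a')).
  { apply (delta0_induction
      (ball #0 (#0 < #2 --> (bit #0 #3 #4 <--> bit #0 #5 #6)))%form
      (n .: b .: a .: b' .: a' .: e0) v0); [delta0| |].
    - intros i Hi. now apply not_lt0 in Hi.
    - intros k IH. change (forall i, i < k -> i < n -> (Bit i b a <-> Bit i b' a')) in IH.
      change (forall i, i < k + 1 -> i < n -> (Bit i b a <-> Bit i b' a')).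
      intros i Hi Hn. apply lt_succ in Hi as [Hi| ->]; [auto|].
      rewrite (HG k Hn), (HG' k Hn). apply Cond_agree.
      intros j Hj. apply IH; eauto using lt_trans. }
  intros i Hi. apply (H n); auto.
Qed.

(** One [b] serves the whole range up to [N]; Sigma1 induction on the stage [k] then finds an [a]
    coding exactly the choices made below [k]. *)
Lemma Greedy_exists p q N : exists b a, Greedy (fun i => Bit i b a) p q (N + 1).
Proof.
  destruct (common_multiple N) as (b & Hb0 & Hb). exists b.
  assert (H : forall k, exists a, forall i, i < N + 1 ->
    (Bit i b a <-> i < k /\ Cond (fun j => Bit j b a) p q i)).
  { apply (sigma1_induction (ball (#2 + 1) (bit #0 #6 #1 <-->
      #0 < #2 /\ greedy_cond #4 #5 #6 #1 #0))%form (N .: p .: q .: b .: e0) v1);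
      [delta0| |].
    - exists 1. change (forall i, i < N + 1 ->
        (Bit i b 1 <-> i < 0 /\ Cond (fun j => Bit j b 1) p q i)).
      intros i _. split; [intros H; now apply Bit_one in H|].
      intros [H _]. now apply not_lt0 in H.
    - intros k [a Ha]. change (forall i, i < N + 1 ->
        (Bit i b a <-> i < k /\ Cond (fun j => Bit j b a) p q i)) in Ha.
      enough (Hx : exists a', forall i, i < N + 1 ->
        (Bit i b a' <-> i < k + 1 /\ Cond (fun j => Bit j b a') p q i)) by exact Hx.
      destruct (classic (k < N + 1 /\ Cond (fun j => Bit j b a) p q k)) as [[Hk HC]|Hn].
      + exists (a * modulus k b). intros i Hi.
        (* Inserting [k] leaves the coded set unchanged below [k], and hence every condition up to
           [k]. *)
        assert (HA : forall m, m < k + 1 -> m < N + 1 ->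
          (Cond (fun j => Bit j b (a * modulus k b)) p q m <->
           Cond (fun j => Bit j b a) p q m)).
        { intros m Hmk Hm. apply Cond_agree. intros j Hj.
          apply (Bit_mul_other N); eauto using lt_trans. intros ->.
          apply lt_succ in Hmk as [Hmk| ->].
          - apply (lt_irrefl m). eauto using lt_trans.
          - now apply (lt_irrefl k). }
        destruct (classic (i = k)) as [->|Hik].
        * rewrite HA; auto; [|apply lt_succ; auto].
          split; [intros _|intros _; apply Bit_mul_self].
          split; [apply lt_succ|]; auto.
        * rewrite (Bit_mul_other N), Ha, lt_succ by auto. split.
          -- intros [H1 H2]. split; [auto|]. apply HA; auto. apply lt_succ; auto.
          -- intros [[H1|H1] H2]; [|tauto]. split; [auto|].
             apply HA in H2; auto. apply lt_succ; auto.
      + exists a. intros i Hi. rewrite Ha, lt_succ by auto. split; [tauto|].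
        intros [[H1| ->] H2]; tauto. }
  destruct (H (N + 1)) as [a Ha]. exists a. intros i Hi. rewrite Ha by auto. tauto.
Qed.

Definition Point (p q : D) : Prop := mem M p P /\ mem M q P /\ Inc p q.

Lemma code_le_r i j : j < code i j + 1.
Proof.
  destruct (code_bound i j) as [d ->].
  replace (i + j + d + 1) with (j + (i + d) + 1) by ring. apply lt_succ_add.
Qed.

Lemma code_le_l i j : i < code i j + 1.
Proof.
  destruct (code_bound i j) as [d ->].
  replace (i + j + d + 1) with (i + (j + d) + 1) by ring. apply lt_succ_add.
Qed.

Lemma le_trans x y z : x < y + 1 -> y < z + 1 -> x < z + 1.
Proof.
  intros [d ->]%lt_succ_exists [f ->]%lt_succ_exists.
  replace (x + d + f + 1) with (x + (d + f) + 1) by ring. apply lt_succ_add.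
Qed.

(** Some code of the greedy stages up to [i] contains [i] if and only if every such code does, which
    makes the set Delta1. The single unbounded variable [c] bounds both [b] and [a]. *)
Lemma antichain_set_exists : exists F, forall n, mem M n F <->
  exists i p q b a, n = code i (code p q) /\ Point p q /\
    Greedy (fun j => Bit j b a) p q (i + 1) /\ Bit i b a.
Proof.
  destruct (delta1_comprehension
    (bex (#1 + 1) (bex (#2 + 1) (bex (#3 + 1)
      (#4 == pair #2 (pair #1 #0) /\ (#1 \in 1 /\ #0 \in 1 /\ inc #1 #0) /\
       bex (#3 + 1) (bex (#4 + 1)
         (greedy #3 #2 #1 #0 (#4 + 1) /\ bit #4 #1 #0))))))%form
    (bex (#1 + 1) (bex (#2 + 1) (bex (#3 + 1)
      (#4 == pair #2 (pair #1 #0) /\ (#1 \in 1 /\ #0 \in 1 /\ inc #1 #0) /\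
       ball (#3 + 1) (ball (#4 + 1)
         (greedy #3 #2 #1 #0 (#4 + 1) --> bit #4 #1 #0))))))%form
    e0 v1) as [F HF]; [delta0|delta0| |].
  - intros n.
    change ((exists c i, i < n + 1 /\ exists p, p < n + 1 /\ exists q, q < n + 1 /\
       n = code i (code p q) /\ Point p q /\
       exists b, b < c + 1 /\ exists a, a < c + 1 /\
         Greedy (fun j => Bit j b a) p q (i + 1) /\ Bit i b a) <->
     (forall c, exists i, i < n + 1 /\ exists p, p < n + 1 /\ exists q, q < n + 1 /\
       n = code i (code p q) /\ Point p q /\
       forall b, b < c + 1 -> forall a, a < c + 1 ->
         Greedy (fun j => Bit j b a) p q (i + 1) -> Bit i b a)).
    split.
    + intros (_ & i & Hi & p & Hp & q & Hq & Hn & HP & b & _ & a & _ & HG & HB) c.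
      exists i; split; [auto|]. exists p; split; [auto|]. exists q; split; [auto|].
      split; [auto|]. split; [auto|]. intros b' _ a' _ HG'.
      apply (Greedy_unique p q (i + 1) b a); auto. apply lt_succ; auto.
    (* The instance at 0 only decodes [n]. The one at [code b a] reaches an actual greedy code, and
       injectivity of [code] identifies the two decodings. *)
    + intros H. destruct (H 0) as (i & Hi & p & Hp & q & Hq & Hn & HP & _).
      destruct (Greedy_exists p q i) as (b & a & HG).
      destruct (H (code b a)) as (i' & _ & p' & _ & q' & _ & Hn' & _ & HB).
      rewrite Hn in Hn'. apply code_inj in Hn' as [<- Hn'].
      apply code_inj in Hn' as [<- <-].
      exists (code b a), i; split; [auto|]. exists p; split; [auto|].
      exists q; split; [auto|]. split; [auto|]. split; [auto|].
      exists b; split; [apply code_le_l|]. exists a; split; [apply code_le_r|].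
      split; [auto|]. apply HB; auto using code_le_l, code_le_r.
  - exists F. intros n. rewrite HF.
    change ((exists c i, i < n + 1 /\ exists p, p < n + 1 /\ exists q, q < n + 1 /\
       n = code i (code p q) /\ Point p q /\
       exists b, b < c + 1 /\ exists a, a < c + 1 /\
         Greedy (fun j => Bit j b a) p q (i + 1) /\ Bit i b a) <->
      exists i p q b a, n = code i (code p q) /\ Point p q /\
        Greedy (fun j => Bit j b a) p q (i + 1) /\ Bit i b a).
    split.
    + intros (_ & i & _ & p & _ & q & _ & Hn & HP & b & _ & a & _ & HG).
      exists i, p, q, b, a. auto.
    + intros (i & p & q & b & a & Hn & HP & HG).
      exists (code b a), i; split; [rewrite Hn; apply code_le_l|].
      exists p; split; [rewrite Hn; eauto using le_trans, code_le_l, code_le_r|].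
      exists q; split; [rewrite Hn; eauto using le_trans, code_le_l, code_le_r|].
      split; [auto|]. split; [auto|].
      exists b; split; [apply code_le_l|]. exists a; split; [apply code_le_r|]. auto.
Qed.

(** By uniqueness the code for stage [i + 1] decides all [j] up to [i], so the greedy recursion
    passes from the finite codes to [F] itself. *)
Lemma antichains_exist : exists F,
  (forall n, mem M n F -> exists i p q, n = code i (code p q) /\ mem M i P /\ Point p q) /\
  forall p q, Point p q -> forall i,
    mem M (code i (code p q)) F <->
    Cond (fun j => mem M (code j (code p q)) F) p q i.
Proof.
  destruct antichain_set_exists as [F HF]. exists F. split.
  - intros n Hn. apply HF in Hn as (i & p & q & b & a & -> & HP & HG & HB).
    exists i, p, q. split; [auto|]. split; [|auto].
    apply (HG i); [apply lt_succ|]; auto.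
  - intros p q HP i. destruct (Greedy_exists p q i) as (b & a & HG).
    assert (H : forall j, j < i + 1 -> (mem M (code j (code p q)) F <-> Bit j b a)).
    { intros j Hj.
      assert (HG' : Greedy (fun j => Bit j b a) p q (j + 1)).
      { apply (Greedy_le _ _ _ _ (i + 1)); [|auto].
        apply lt_succ_exists in Hj as [d ->].
        replace (j + d + 1 + 1) with (j + 1 + d + 1) by ring. apply lt_succ_add. }
      rewrite HF. split.
      - intros (j' & p' & q' & b' & a' & Hn & _ & HG'' & HB).
        apply code_inj in Hn as [<- Hn]. apply code_inj in Hn as [<- <-].
        apply (Greedy_unique p q (j + 1) b' a'); auto. apply lt_succ; auto.
      - intros HB. exists j, p, q, b, a. auto. }
    assert (Hi : i < i + 1) by (apply lt_succ; auto).
    rewrite (H i Hi), (HG i Hi). apply Cond_agree. intros j Hj. symmetry. apply H.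
    apply lt_succ. auto.
Qed.

(** * The linear order of the greedy antichains *)

Context (e1 : nat -> D).
Context (HPO : sat M e1 v1 (partial_order 1 0)).
Context (H22 : sat M e1 v1 (no_two_plus_two 1 0)).

Definition leP (i j : D) : Prop := mem M (code i j) R.
Definition ltP (i j : D) : Prop := leP i j /\ i <> j.

Lemma leP_field i j : leP i j -> mem M i P /\ mem M j P.
Proof.
  intros H. destruct HPO as (Hsub & _).
  destruct (Hsub (code i j) H) as (i' & j' & Hi & Hj & Hc).
  apply code_inj in Hc as [-> ->]. split; assumption.
Qed.

Lemma leP_trans i j k : leP i j -> leP j k -> leP i k.
Proof.
  intros H1 H2. destruct HPO as (_ & _ & Ht & _).
  apply (Ht k j i); split; auto.
  - apply (leP_field i j H1).
  - split; [apply (leP_field i j H1)|apply (leP_field j k H2)].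
Qed.

Lemma leP_antisym i j : leP i j -> leP j i -> i = j.
Proof.
  intros H1 H2. destruct HPO as (_ & _ & _ & Ha).
  apply (Ha j i); split; auto; apply (leP_field i j H1).
Qed.

Lemma ltP_trans i j k : ltP i j -> ltP j k -> ltP i k.
Proof.
  intros [H1 N1] [H2 N2]. split; [now apply (leP_trans i j)|].
  intros ->. apply N1. now apply leP_antisym.
Qed.

Lemma two_plus_two i j i' j' : ltP i j -> ltP i' j' -> leP i j' \/ leP i' j.
Proof.
  intros H H'.
  apply (H22 j' i' j i); [|now split].
  destruct H as [H _], H' as [H' _]. apply leP_field in H, H'. cbn; tauto.
Qed.

Lemma Inc_not_ltP i j : Inc i j -> ~ ltP i j.
Proof. intros [H _] [HL HN]. auto. Qed.

Lemma Inc_or_ltP i j : Inc i j \/ ltP i j \/ ltP j i.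
Proof.
  destruct (classic (i = j)) as [->|Hne]; [left; apply Inc_refl|].
  destruct (classic (leP i j)) as [H|H]; [right; left; split; auto|].
  destruct (classic (leP j i)) as [H'|H']; [right; right; split; auto|].
  left. split; intros; tauto.
Qed.

Context (F : sets M).
Context (HF1 : forall n, mem M n F ->
  exists i p q, n = code i (code p q) /\ mem M i P /\ Point p q).
Context (HF2 : forall p q, Point p q -> forall i,
  mem M (code i (code p q)) F <->
  Cond (fun j => mem M (code j (code p q)) F) p q i).

Definition In_antichain (x i : D) : Prop := mem M (code i x) F.

Definition Is_point (x : D) : Prop := exists p q, x = code p q /\ Point p q.

(** The numerically larger of the two was tested against the smaller. *)
Lemma antichain_Inc x i j : Is_point x ->
  In_antichain x i -> In_antichain x j -> Inc i j.
Proof.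
  intros Hx Hi Hj. destruct Hx as (p & q & -> & HP).
  destruct (lt_trichotomy i j) as [Hl|[->|Hl]].
  - destruct (proj1 (HF2 p q HP j) Hj) as (_ & _ & _ & H). apply Inc_sym; auto.
  - apply Inc_refl.
  - destruct (proj1 (HF2 p q HP i) Hi) as (_ & _ & _ & H). auto.
Qed.

(** Every member was tested against [p] and [q], so these in turn pass the test against the
    members. *)
Lemma antichain_base p q : Point p q ->
  In_antichain (code p q) p /\ In_antichain (code p q) q.
Proof.
  intros HP. pose proof HP as (Hp & Hq & Hpq).
  assert (Hg : forall j, In_antichain (code p q) j -> Inc p j /\ Inc q j).
  { intros j Hj. destruct (proj1 (HF2 p q HP j) Hj) as (_ & H1 & H2 & _).
    split; now apply Inc_sym. }
  split; apply (HF2 p q HP).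
  - split; [exact Hp|]. split; [apply Inc_refl|]. split; [exact Hpq|].
    intros j _ Hj. now apply Hg.
  - split; [exact Hq|]. split; [now apply Inc_sym|]. split; [apply Inc_refl|].
    intros j _ Hj. now apply Hg.
Qed.

(** * Separation of antichains *)

Definition Sep (x y : D) : Prop :=
  exists i j, In_antichain x i /\ In_antichain y j /\ ltP i j.

Lemma Sep_irrefl x : Is_point x -> ~ Sep x x.
Proof.
  intros Hx (i & j & Hi & Hj & Hl). apply (Inc_not_ltP i j); auto.
  now apply (antichain_Inc x).
Qed.

(** The absence of 2+2, applied to [i < j] and [j' < k], gives [i <= k] or [j' <= j]; in the latter
    case [j' = j], as both lie in the antichain of [y]. *)
Lemma Sep_trans x y z : Is_point y -> Sep x y -> Sep y z -> Sep x z.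
Proof.
  intros Hy (i & j & Hi & Hj & Hl) (j' & k & Hj' & Hk & Hl').
  assert (Hjj : Inc j' j) by now apply (antichain_Inc y).
  exists i, k. split; [auto|]. split; [auto|].
  destruct (two_plus_two _ _ _ _ Hl Hl') as [H|H].
  - split; [exact H|]. intros ->.
    apply (Inc_not_ltP j' j); [auto|]. now apply (ltP_trans j' k).
  - apply Hjj in H as ->. now apply (ltP_trans i j).
Qed.

Lemma Sep_asym x y : Is_point x -> Is_point y -> Sep x y -> ~ Sep y x.
Proof. intros Hx Hy H1 H2. apply (Sep_irrefl x Hx). now apply (Sep_trans x y). Qed.

(** The bound reaches the generators of both antichains, since a code bounds its components. *)
Definition Sepb (x y : D) : Prop :=
  exists i, i < x + y + 1 /\ exists j, j < x + y + 1 /\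
    In_antichain x i /\ In_antichain y j /\ ltP i j.

Lemma Sepb_Sep x y : Sepb x y -> Sep x y.
Proof. intros (i & _ & j & _ & H). now exists i, j. Qed.

Lemma le_add_r x y z : x < y + 1 -> x < y + z + 1.
Proof.
  intros [d ->]%lt_succ_exists. rewrite <- (add_assoc x). apply lt_succ_add.
Qed.

(** Antichains not separated below [x + y] agree: up to there by comparability,
    and beyond because they already contain each other's generators. *)
Lemma antichain_agree x y : Is_point x -> Is_point y -> ~ Sepb x y -> ~ Sepb y x ->
  forall i, In_antichain x i <-> In_antichain y i.
Proof.
  intros Hx Hy N1 N2.
  (* One inclusion at [k], given agreement below [k]. The greedy rule for [y] accepts [k] once [k]
     is compatible with the generators of [y]. *)
  assert (half : forall x y k, Is_point x -> Is_point y -> ~ Sepb x y -> ~ Sepb y x ->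
    (forall i, i < k -> (In_antichain x i <-> In_antichain y i)) ->
    In_antichain x k -> In_antichain y k).
  { clear x y Hx Hy N1 N2. intros x y k Hx (p & q & Hc & HP) N1 N2 IH Hk.
    pose proof (antichain_base p q HP) as [Hp Hq]. rewrite <- Hc in Hp, Hq.
    assert (Hg : forall g, g < y + 1 -> In_antichain y g -> Inc k g).
    { intros g Hgy Hg. destruct (lt_succ_cases k (x + y)) as [Hl|Hl].
      - assert (Hgl : g < x + y + 1) by (rewrite (add_comm x); now apply le_add_r).
        destruct (Inc_or_ltP k g) as [H|[H|H]]; [exact H| |]; exfalso.
        + apply N1. exists k. split; [exact Hl|]. exists g. auto.
        + apply N2. rewrite (add_comm x y) in *. exists g. split; [exact Hgl|].
          exists k. auto.
      (* Here [g] is less than [k], so agreement below [k] puts [g] into the antichain of [x],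
         beside [k]. *)
      - apply (antichain_Inc x); auto. apply IH; auto.
        apply (le_add_r _ _ x), lt_succ in Hgy. rewrite (add_comm y x) in Hgy.
        destruct Hgy as [Hgy| ->]; eauto using lt_trans. }
    assert (HpP : mem M k P).
    { destruct Hx as (p' & q' & -> & HP'). exact (proj1 (proj1 (HF2 p' q' HP' k) Hk)). }
    rewrite Hc. apply HF2; [exact HP|]. split; [exact HpP|].
    split; [apply Hg; auto; rewrite Hc; apply code_le_l|].
    split; [apply Hg; auto; rewrite Hc; apply code_le_r|].
    intros j Hj Hjy. rewrite <- Hc in Hjy. apply (antichain_Inc x); auto.
    now apply IH. }
  assert (H : forall k i, i < k -> (In_antichain x i <-> In_antichain y i)).
  { apply (delta0_induction
      (ball #0 (pair #0 #2 \in 0 <--> pair #0 #3 \in 0))%form (x .: y .: e0) (F .: v1));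
      [delta0| |].
    - intros i Hi. now apply not_lt0 in Hi.
    - intros k IH. change (forall i, i < k -> (In_antichain x i <-> In_antichain y i)) in IH.
      change (forall i, i < k + 1 -> (In_antichain x i <-> In_antichain y i)).
      intros i Hi. apply lt_succ in Hi as [Hi| ->]; [auto|].
      split; apply half; auto. intros i Hi. symmetry. auto. }
  intros i. apply (H (i + 1)). apply lt_succ. auto.
Qed.

Lemma Sep_Sepb x y : Is_point x -> Is_point y -> Sep x y -> Sepb x y.
Proof.
  intros Hx Hy H. apply NNPP. intros N1.
  destruct (classic (Sepb y x)) as [H2|N2].
  - apply (Sep_asym x y); auto using Sepb_Sep.
  - destruct H as (i & j & Hi & Hj & Hl).
    apply (antichain_agree x y) in Hi; auto.
    apply (Inc_not_ltP i j); auto. now apply (antichain_Inc y).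
Qed.

Lemma not_Sep_agree x y : Is_point x -> Is_point y -> ~ Sep x y -> ~ Sep y x ->
  forall i, In_antichain x i <-> In_antichain y i.
Proof. intros Hx Hy N1 N2. apply antichain_agree; auto using Sepb_Sep. Qed.

Lemma Sep_agree_l x x' y : (forall i, In_antichain x i <-> In_antichain x' i) ->
  Sep x y -> Sep x' y.
Proof. intros H (i & j & Hi & Hj). exists i, j. rewrite <- H. auto. Qed.

Lemma Sep_agree_r x y y' : (forall i, In_antichain y i <-> In_antichain y' i) ->
  Sep x y -> Sep x y'.
Proof. intros H (i & j & Hi & Hj & Hl). exists i, j. rewrite <- H. auto. Qed.

(** Distinct codes of the same antichain are ordered as numbers. *)
Definition Lle (x y : D) : Prop := Sep x y \/ ~ Sep y x /\ x < y + 1.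

Lemma Lle_total x y : Is_point x -> Is_point y -> Lle x y \/ Lle y x.
Proof.
  intros Hx Hy. unfold Lle.
  destruct (classic (Sep x y)) as [H|H]; [tauto|].
  destruct (classic (Sep y x)) as [H'|H']; [tauto|].
  destruct (lt_succ_cases x y) as [Hl|Hl]; [tauto|].
  right; right. split; [auto|]. apply lt_succ; auto.
Qed.

Lemma Lle_refl x : Is_point x -> Lle x x.
Proof. intros Hx. right. split; [now apply Sep_irrefl|]. apply lt_succ; auto. Qed.

Lemma Lle_antisym x y : Is_point x -> Is_point y -> Lle x y -> Lle y x -> x = y.
Proof.
  intros Hx Hy [H|[N Hl]] [H'|[N' Hl']]; try tauto.
  - exfalso. now apply (Sep_asym x y).
  - apply lt_succ in Hl as [Hl| ->]; [|auto].
    apply lt_succ in Hl' as [Hl'| ->]; [|auto].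
    exfalso. apply (lt_irrefl x). eauto using lt_trans.
Qed.

(** The order is lexicographic, first by antichain and then by code. Points separated in neither
    direction have equal antichains, so separations carry over from one to the other. *)
Lemma Lle_trans x y z : Is_point x -> Is_point y -> Is_point z ->
  Lle x y -> Lle y z -> Lle x z.
Proof.
  intros Hx Hy Hz Hxy Hyz.
  destruct (classic (Sep x z)) as [H|N]; [now left|]. right.
  destruct (classic (Sep z x)) as [H|N'].
  - exfalso. destruct Hxy as [S1|[N1 L1]], Hyz as [S2|[N2 L2]].
    + apply N. now apply (Sep_trans x y).
    + apply N2. now apply (Sep_trans z x).
    + apply N1. now apply (Sep_trans y z).
    + destruct (classic (Sep x y)) as [S1|M1].
      * apply N2. now apply (Sep_trans z x).
      * apply N2. apply (Sep_agree_r z x y); [now apply not_Sep_agree|auto].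
  - split; [auto|].
    pose proof (not_Sep_agree x z Hx Hz N N') as Ha.
    destruct Hxy as [S1|[N1 L1]].
    + exfalso. assert (S2 : Sep z y) by now apply (Sep_agree_l x z y).
      destruct Hyz as [S3|[N3 _]]; [now apply (Sep_asym z y)|auto].
    + destruct Hyz as [S2|[N2 L2]]; [|now apply (le_trans x y)].
      exfalso. apply N1. apply (Sep_agree_r y z x); auto. intros i. now symmetry.
Qed.

Lemma Lle_of_Sep x y : Is_point x -> Is_point y -> Sep x y -> Lle x y /\ x <> y.
Proof.
  intros Hx Hy H. split; [now left|]. intros ->. now apply (Sep_irrefl y).
Qed.

Lemma Lle_not_Sep x y : Is_point x -> Is_point y -> Lle x y -> ~ Sep y x.
Proof. intros Hx Hy [H|[H _]]; [now apply Sep_asym|exact H]. Qed.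

(** If [i] were comparable to a member of the antichain of [z], this would separate [y] from [z] or
    [z] from [x], against the assumed order. So the greedy rule for [z] accepts [i]. *)
Lemma antichain_convex x y z i : Is_point x -> Is_point y -> Is_point z ->
  In_antichain x i -> In_antichain y i -> Lle x z -> Lle z y -> In_antichain z i.
Proof.
  intros Hx Hy Hz Hxi Hyi Hxz Hzy.
  apply Lle_not_Sep in Hxz, Hzy; auto.
  assert (Hg : forall g, In_antichain z g -> Inc i g).
  { intros g Hg. destruct (Inc_or_ltP i g) as [H|[H|H]]; [exact H| |]; exfalso.
    - apply Hzy. now exists i, g.
    - apply Hxz. now exists g, i. }
  destruct Hz as (p & q & -> & HP).
  destruct (antichain_base p q HP) as [Hp Hq].
  apply HF2; [exact HP|]. split; [|split; [auto|split; [auto|]]].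
  - destruct Hx as (p' & q' & -> & HP'). exact (proj1 (proj1 (HF2 p' q' HP' i) Hxi)).
  - intros j _ Hj. now apply Hg.
Qed.

(** * The linear order as a set, and the interval representation *)

Lemma point_set : exists L, forall n, mem M n L <-> Is_point n.
Proof.
  destruct (delta0_comprehension (bex (#0 + 1) (bex (#1 + 1)
    (#2 == pair #1 #0 /\ (#1 \in 1 /\ #0 \in 1 /\ inc #1 #0))))%form e0 v1)
    as [L HL]; [delta0|].
  exists L. intros n. rewrite HL.
  change ((exists p, p < n + 1 /\ exists q, q < n + 1 /\ n = code p q /\ Point p q)
    <-> Is_point n).
  split.
  - intros (p & _ & q & _ & H). now exists p, q.
  - intros (p & q & -> & H). exists p. split; [apply code_le_l|].
    exists q. split; [apply code_le_r|auto].
Qed.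

(** Set variable 1 is [F] and 2 is [R], since [L] occupies 0 in the comprehension below. *)
Definition sep (x y : term) : form :=
  bex (x + y + 1) (bex (tshift (x + y + 1))
    (pair #1 (tshift (tshift x)) \in 1 /\ pair #0 (tshift (tshift y)) \in 1
     /\ (pair #1 #0 \in 2 /\ ~ #1 == #0)))%form.

Lemma sep_D0 x y : Delta0 (sep x y).
Proof. unfold sep. delta0. Qed.

#[local] Hint Resolve sep_D0 : delta0.

(** Separation occurs in [Lle] both positively and negatively; on points it may be replaced by
    [Sepb], which makes the definition Delta0. *)
Lemma point_order_set : exists RL, forall n, mem M n RL <->
  exists x y, n = code x y /\ Is_point x /\ Is_point y /\ Lle x y.
Proof.
  destruct point_set as [L HL].
  destruct (delta0_comprehension (bex (#0 + 1) (bex (#1 + 1)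
    (#2 == pair #1 #0 /\ #1 \in 0 /\ #0 \in 0 /\
     (sep #1 #0 \/ ~ sep #0 #1 /\ #1 < #0 + 1))))%form e0 (L .: F .: v1))
    as [RL HR]; [delta0|].
  exists RL. intros n. rewrite HR.
  change ((exists x, x < n + 1 /\ exists y, y < n + 1 /\ n = code x y /\
      mem M x L /\ mem M y L /\ (Sepb x y \/ ~ Sepb y x /\ x < y + 1))
    <-> exists x y, n = code x y /\ Is_point x /\ Is_point y /\ Lle x y).
  assert (H : forall x y, Is_point x -> Is_point y ->
    (Sepb x y \/ ~ Sepb y x /\ x < y + 1 <-> Lle x y)).
  { intros x y Hx Hy. unfold Lle.
    assert (E : forall x y, Is_point x -> Is_point y -> Sepb x y <-> Sep x y)
      by (split; auto using Sepb_Sep, Sep_Sepb).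
    now rewrite !E. }
  split.
  - intros (x & _ & y & _ & Hn & Hx & Hy & Hl). exists x, y.
    rewrite HL in *. apply H in Hl; auto.
  - intros (x & y & -> & Hx & Hy & Hl). exists x. split; [apply code_le_l|].
    exists y. split; [apply code_le_r|]. rewrite !HL. apply H in Hl; auto.
Qed.

Lemma interval_order_of_antichains : sat M e1 v1 (interval_order 1 0).
Proof.
  destruct point_set as [L HL]. destruct point_order_set as [RL HR].
  assert (HRc : forall x y, mem M (code x y) RL <-> Is_point x /\ Is_point y /\ Lle x y).
  { intros x y. rewrite HR. split; [|intros H; now exists x, y].
    intros (x' & y' & Hc & H). apply code_inj in Hc as [-> ->]. exact H. }
  exists L, RL, F. split; [|split; [|split]].
  - split.
    + split; [|split; [|split]].
      * intros n Hn. apply HR in Hn as (x & y & Hn & Hx & Hy & _).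
        exists x, y. split; [now apply HL|]. split; [now apply HL|exact Hn].
      * intros x Hx. apply HL in Hx. apply HRc. auto using Lle_refl.
      * intros z y x (Hx & Hy & Hz) [H1 H2]. apply HL in Hx, Hy, Hz. apply HRc in H1, H2.
        apply HRc. split; [exact Hx|]. split; [exact Hz|].
        apply (Lle_trans x y z); tauto.
      * intros y x (Hx & Hy) [H1 H2]. apply HL in Hx, Hy. apply HRc in H1, H2.
        apply (Lle_antisym x y); tauto.
    + intros y x (Hx & Hy). apply HL in Hx, Hy.
      destruct (Lle_total x y Hx Hy); [left|right]; apply HRc; auto.
  - intros n Hn. apply HF1 in Hn as (i & p & q & Hn & Hi & HP).
    exists i, (code p q). split; [exact Hi|].
    split; [apply HL; now exists p, q|exact Hn].
  - split.
    + intros p Hp. assert (HP : Point p p) by (repeat split; auto).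
      exists (code p p). split; [apply HL; now exists p, p|].
      now apply antichain_base.
    + intros p Hp x y z ([Hx Fx] & [Hy Fy] & Hz) [[H1 _] [H2 _]].
      split; [exact Hz|]. apply HL in Hx, Hy, Hz. apply HRc in H1, H2.
      apply (antichain_convex x y z p); try assumption; tauto.
  - intros p q [Hp Hq]. split.
    + intros Hpq x y [[Hx Fx] [Hy Fy]]. apply HL in Hx, Hy.
      assert (HS : Sep x y) by now exists p, q.
      destruct (Lle_of_Sep x y Hx Hy HS) as [Hle Hne].
      split; [now apply HRc|exact Hne].
    + intros H.
      assert (Hall : forall x y, Is_point x -> Is_point y ->
        In_antichain x p -> In_antichain y q -> Lle x y /\ x <> y).
      { intros x y Hx Hy Hxp Hyq. destruct (H x y) as [Hle Hne].
        - split; split; try assumption; now apply HL.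
        - split; [now apply HRc in Hle|exact Hne]. }
      destruct (Inc_or_ltP p q) as [Hi|[Hl|Hl]]; [exfalso|exact Hl|exfalso].
      (* Both elements lie in the antichain that they generate, whose code would be strictly below
         itself. *)
      * destruct (antichain_base p q) as [Hxp Hxq]; [now split|].
        assert (Hx : Is_point (code p q)) by (exists p, q; now split).
        now destruct (Hall (code p q) (code p q)).
      (* If [q] is below [p], the antichains coded by [code q q] and [code p p] are separated the
         wrong way round. *)
      * assert (HPp : Point p p) by (split; auto using Inc_refl).
        assert (HPq : Point q q) by (split; auto using Inc_refl).
        assert (Hx : Is_point (code p p)) by now exists p, p.
        assert (Hy : Is_point (code q q)) by now exists q, q.
        destruct (antichain_base p p HPp) as [Hxp _].
        destruct (antichain_base q q HPq) as [Hyq _].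
        destruct (Hall _ _ Hx Hy Hxp Hyq) as [Hle _].
        apply (Lle_not_Sep _ _ Hx Hy Hle). now exists q, p.
Qed.

End RCA0_models.

Theorem theorem4p2 :
  provable RCA0
    (AllS (AllS (partial_order 1 0 /\ no_two_plus_two 1 0 -->
       interval_order 1 0)))%form.
Proof.
  apply completeness; [now split|].
  intros M HM e v P R [HPO H22].
  destruct (antichains_exist M HM v P R) as (F & HF1 & HF2).
  now apply (interval_order_of_antichains M HM v P R e HPO H22 F).
Qed.
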